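(* Let $C_{\mathsf{MSE}}>0$. There exist constants $c>0$ and $N_0\in\mathbb{N}$, depending only on $C_{\mathsf{MSE}}$, such that the following holds. For all integers $d\ge 1$ and $n\ge N_0$, every measurable $f\colon(\mathbb{R}^d)^n\to\mathbb{R}^d$ that is $(C_{\mathsf{MSE}},\frac{d}{n})$-uniformly MSE-accurate for the Gaussian class $\{\mathcal N(\mu,\mathbb I_d)\}_{\mu\in\mathbb R^d}$, and every $\eta\in(0,1)$ with $\lfloor \eta n\rfloor\ge 1$, we have \[\sup_{\mu\in\mathbb R^d}\mathsf{ES}_{\eta,2}(f;\mu)\ \ge\ c\left(\eta+\sqrt{\frac{\eta d}{n}}\right).\]
   Context: For datasets $x,x'\in(\mathbb R^d)^n$, the Hamming distance is $d_H(x,x')=\#\{i\in[n]: x_i\neq x_i'\}$. For a function $f\colon(\mathbb R^d)^n\to\mathbb R^d$ and $\eta\in(0,1)$, the pointwise empirical sensitivity is $S^f_\eta(X)=\sup_{X'\colon d_H(X,X')\le\lfloor\eta n\rfloor}\|f(X)-f(X')\|_2$. For $q\in\{1,2\}$, the distributional empirical sensitivity is $\mathsf{ES}_{\eta,q}(f;\mu)=\big(\mathbb E_{X\sim\mathcal N(\mu,\mathbb I_d)^{\otimes n}}[S^f_\eta(X)^q]\big)^{1/q}$. An estimator $f$ is $(C_{\mathsf{MSE}},\frac dn)$-uniformly MSE-accurate if $\sup_{\mu\in\mathbb R^d}\mathbb E_{X\sim\mathcal N(\mu,\mathbb I_d)^{\otimes n}}\|f(X)-\mu\|_2^2\le C_{\mathsf{MSE}}\frac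 dn$. *)

(* Defs.v *)
From HB Require Import structures.
From mathcomp Require Import all_boot all_order all_algebra.
From mathcomp Require Import all_classical all_reals all_analysis.
Set Implicit Arguments. Unset Strict Implicit. Unset Printing Implicit Defensive.
Import Order.TTheory GRing.Theory Num.Theory.
Local Open Scope classical_set_scope.
Local Open Scope ring_scope.

Section Defs.
Variable R : realType.

(* A dataset X in (R^d)^n is an n x d matrix; the i-th sample is row i X. *)

Definition l2norm (d : nat) (v : 'rV[R]_d) : R :=
  Num.sqrt (\sum_(j < d) v 0 j ^+ 2).

Definition hamming (n d : nat) (X X' : 'M[R]_(n, d)) : nat :=
  #|[set i : 'I_n | row i X != row i X']|.

Definition floor_eta_n (n : nat) (eta : R) : int := Num.floor (eta * n%:R).

Definition pointwise_sens (n d : nat) (f : 'M[R]_(n, d) -> 'rV[R]_d)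
    (eta : R) (X : 'M[R]_(n, d)) : \bar R :=
  ereal_sup [set (l2norm (f X - f X'))%:E | X' in
               [set X' | (hamming X X')%:Z <= floor_eta_n n eta]].

(* Iterated integration of g against independent N(m k, 1) laws in the
   coordinates listed in s (the other coordinates are read from x).
   For nonnegative functions this computes the integral against the product
   Gaussian measure (Tonelli). *)
Fixpoint gauss_iter (I : eqType) (s : seq I) (m : I -> R)
    (g : (I -> R) -> \bar R) (x : I -> R) : \bar R :=
  match s with
  | [::] => g x
  | k :: s' => (\int[normal_prob (m k) 1]_t
                  gauss_iter s' m g (fun j => if j == k then t else x j))%E
  end.

(* E_{X ~ N(mu, I_d)^{(x) n}} [g X] for nonnegative g. *)
Definition gauss_expect (n d : nat) (mu : 'rV[R]_d)
    (g : 'M[R]_(n, d) -> \bar R) : \bar R :=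
  gauss_iter (index_enum (prod 'I_n 'I_d))
    (fun ij => mu 0 ij.2)
    (fun x => g (\matrix_(i, j) x (i, j))) (fun _ => 0).

Definition ES2 (n d : nat) (f : 'M[R]_(n, d) -> 'rV[R]_d) (eta : R)
    (mu : 'rV[R]_d) : \bar R :=
  sqrte (gauss_expect mu (fun X => (pointwise_sens f eta X * pointwise_sens f eta X)%E)).

Definition unif_MSE_accurate (n d : nat) (f : 'M[R]_(n, d) -> 'rV[R]_d)
    (C : R) : Prop :=
  forall mu : 'rV[R]_d,
    (gauss_expect mu (fun X => ((l2norm (f X - mu)) ^+ 2)%:E)
       <= (C * (d%:R / n%:R))%:E)%E.

(* Borel sigma-algebra on (R^d)^n = R^{n x d}: generated by the coordinate maps. *)
Definition mx_measurable (n d : nat) (A : set 'M[R]_(n, d)) : Prop :=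
  <<s \bigcup_(ij in [set: ('I_n * 'I_d)%type])
        [set (fun X : 'M[R]_(n, d) => X ij.1 ij.2) @^-1` B
           | B in [set B : set R | measurable B]] >> A.

Definition mx_measurable_fun (n d : nat) (f : 'M[R]_(n, d) -> 'rV[R]_d) : Prop :=
  forall (j : 'I_d) (B : set R), measurable B ->
    mx_measurable ((fun X => f X 0 j) @^-1` B).

End Defs.

(* Main.v *)
(* Write k for the number of rows an adversary may change, G_m for the product
   of the laws N(m_i, 1), and Lambda_a for the density of G_(m+a) with respect
   to G_m, so that E[Lambda_a Lambda_b] = exp <a, b> under G_m.

   sqrt(k d)/n: by averaging over the cube {0, v}^d with v of order 1/sqrt n,
   some vertex mu is such that flipping its j-th coordinate moves the mean of
   f_j by at least v/2 on average over j.  Flip that coordinate for one block of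
   k rows after the other.  As f with the b-th block of rows set to 0 does not
   see the b-th flip, the b-th increment is the mean under mu of
   (f - f_cleared) times a difference of densities Lambda, and |f - f_cleared|
   is at most the sensitivity.  The squared norms of the density differences
   telescope.

   k/n: increase a single coordinate of mu by v = 1/sqrt n row by row, in
   arbitrarily many sweeps over the n rows, coupling N(c, 1) and N(c + v, 1) by
   reflection.  Let W_j(x) be the expectation of f at the j-th jump of the rest
   of the walk started at x.  Then |W_j - f| is at most the sensitivity for
   j <= k, and along one step the sum of the means of W_1, ..., W_k changes by
   the mean of W_k - f over the jump.  After many sweeps this sum must have grown
   by k times the displacement, while each sweep contributes at most a constant
   times sqrt n times the L2 norm of the sensitivity.

   The sensitivity is never integrated itself, since it need not be measurable:
   it only bounds measurable functions from above. *)

Require Import Defs.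
From HB Require Import structures.
From mathcomp Require Import all_boot all_order all_algebra.
From mathcomp Require Import all_classical all_reals all_analysis.
From mathcomp Require Import measurable_realfun ring lra.
Import Order.TTheory GRing.Theory Num.Theory.
Set SsrOldRewriteGoalsOrder.
Set Implicit Arguments. Unset Strict Implicit. Unset Printing Implicit Defensive.
Local Open Scope classical_set_scope.
Local Open Scope ring_scope.

(** * The normal law on the line *)

Section GaussianLine.
Variable R : realType.
Implicit Types (a b t v : R) (g : R -> \bar R).
Local Notation leb := (@lebesgue_measure R).
Local Notation normal b := (normal_prob b (1 : R)).

(** The integral of a nonnegative function is a supremum over the simple functions below it, so a
    larger function has more competitors, measurable or not. This is how the sensitivity can serve
    as an upper bound. *)
Lemma ge0_le_integral_nomeas d (T : measurableType d)
    (mu : {measure set T -> \bar R}) (f1 f2 : T -> \bar R) :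
  (forall x, 0 <= f1 x)%E -> (forall x, f1 x <= f2 x)%E ->
  (\int[mu]_x f1 x <= \int[mu]_x f2 x)%E.
Proof.
move=> f10 f12; rewrite !ge0_integralTE//; last first.
  by move=> x; exact: le_trans (f10 x) (f12 x).
apply: ge_ereal_sup => _ [h /= hf <-]; apply: ereal_sup_ubound.
by exists h => // x; exact: le_trans (hf x) (f12 x).
Qed.

Import HBNNSimple.

(** Both sides agree on indicators, hence on simple functions, and monotone convergence extends this
    to [g]. *)
Lemma ge0_integral_normal b g : measurable_fun [set: R] g ->
  (forall x, 0 <= g x)%E ->
  (\int[normal b]_x g x = \int[leb]_x (g x * (normal_pdf b 1 x)%:E))%E.
Proof.
move=> mg g0.
have mpdf : measurable_fun setT (fun x => (normal_pdf b 1 x)%:E).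
  by apply/measurable_EFinP; exact: measurable_normal_pdf.
have pdf0 x : (0 <= (normal_pdf b 1 x)%:E)%E by rewrite lee_fin normal_pdf_ge0.
pose g_ := nnsfun_approx measurableT mg.
have nd_g x : {homo (fun n => g_ n x) : m n / (m <= n)%N >-> m <= n}.
  by move=> m n mn; have /lefP := nd_nnsfun_approx measurableT mg mn; apply.
have mg_ n : measurable_fun [set: R] (fun x => (g_ n x)%:E).
  exact/measurable_EFinP.
transitivity (limn (fun n => \int[normal b]_x (g_ n x)%:E))%E.
  rewrite -monotone_convergence//.
  - apply: eq_integral => y _; apply/esym/cvg_lim => //.
    by apply: cvg_nnsfun_approx.
  - by move=> n y _; rewrite lee_fin.
  - by move=> y _ m n mn; rewrite lee_fin; exact: nd_g.
rewrite [X in limn X](_ : _ =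
    (fun n => \int[leb]_x ((g_ n x)%:E * (normal_pdf b 1 x)%:E)))%E.
  rewrite -monotone_convergence//; last 3 first.
    - by move=> n; apply: emeasurable_funM; [exact: mg_|exact: mpdf].
    - by move=> n x _ /=; rewrite mule_ge0// lee_fin.
    - move=> x _ m n mn; rewrite lee_wpmul2r// lee_fin.
      exact: nd_g.
  apply: eq_integral => x _ /=; apply/cvg_lim => //.
  apply: cvgeZr => //; exact: cvg_nnsfun_approx.
apply/funext => n.
have mpre r : measurable (g_ n @^-1` [set r]) by [].
have mind r :
    measurable_fun [set: R] (fun x => (\1_(g_ n @^-1` [set r]) x)%:E : \bar R).
  exact/measurable_EFinP.
have mrind r :
    measurable_fun [set: R] (fun x => (r * \1_(g_ n @^-1` [set r]) x)%:E : \bar R).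
  by apply/measurable_EFinP; exact: measurable_funM.
have mpind r : measurable_fun [set: R] (fun x =>
    (\1_(g_ n @^-1` [set r]) x)%:E * (normal_pdf b 1 x)%:E)%E.
  by apply: emeasurable_funM; [exact: mind|exact: mpdf].
transitivity (\sum_(k \in range (g_ n))
    \int[leb]_x (k%:E * ((\1_(g_ n @^-1` [set k]) x)%:E * (normal_pdf b 1 x)%:E)))%E.
  under eq_integral do rewrite fimfunE -fsumEFin//.
  rewrite ge0_integral_fsum//; last first.
  - by move=> y x _; rewrite nnfun_muleindic_ge0.
  apply: eq_fsbigr => r; rewrite inE => -[y _ ry].
  have r0 : (0 <= r%:E :> \bar R)%E by rewrite lee_fin -ry.
  under eq_integral do rewrite EFinM.
  rewrite ge0_integralZl//; last exact: mind.
  rewrite integral_indic//.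
  rewrite ge0_integralZl//; last 2 first.
  - exact: mpind.
  - by move=> x _; rewrite mule_ge0// lee_fin.
  congr (_ * _)%E; rewrite setIT.
  transitivity (\int[leb]_(x in g_ n @^-1` [set r]) (normal_pdf b 1 x)%:E)%E => //.
  rewrite [LHS]integral_mkcond.
  apply: eq_integral => x _; rewrite patchE indicE.
  by case: ifP; rewrite ?mul1e ?mul0e.
  exact: mpre.
rewrite -ge0_integral_fsum//.
- apply: eq_integral => x _; rewrite [in RHS]fimfunE -fsumEFin//.
  rewrite ge0_mule_fsuml//.
    by apply: eq_fsbigr => r _; rewrite muleA.
  by move=> r; rewrite nnfun_muleindic_ge0.
- by move=> r; apply: emeasurable_funM; [exact: measurable_cst|exact: mpind].
- by move=> r x _; rewrite muleA mule_ge0// nnfun_muleindic_ge0.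
Qed.

(** The density of N(a + v, 1) with respect to N(a, 1). *)
Definition lratio v a t : R := expR (v * (t - a) - v ^+ 2 / 2).

Lemma lratio_ge0 v a t : 0 <= lratio v a t. Proof. exact: expR_ge0. Qed.

Lemma measurable_lratio v a : measurable_fun setT (lratio v a).
Proof.
apply: measurableT_comp => //; apply: measurable_funB => //.
by apply: measurable_funM => //; exact: measurable_funB.
Qed.

Lemma normal_pdf_lratio v a t :
  normal_pdf (a + v) 1 t = lratio v a t * normal_pdf a 1 t.
Proof.
rewrite !normal_pdfE// /normal_fun mulrCA -expRD; congr (_ * expR _).
by rewrite expr1n; field.
Qed.

Lemma ge0_integral_normal_shift v a g : measurable_fun [set: R] g ->
  (forall x, 0 <= g x)%E ->
  (\int[normal (a + v)]_x g x = \int[normal a]_x (g x * (lratio v a x)%:E))%E.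
Proof.
move=> mg g0.
have ml : measurable_fun [set: R] (fun x => (lratio v a x)%:E).
  by apply/measurable_EFinP; exact: measurable_lratio.
have mgl : measurable_fun [set: R] (fun x => g x * (lratio v a x)%:E)%E.
  exact: emeasurable_funM mg ml.
have gl0 x : (0 <= g x * (lratio v a x)%:E)%E.
  by rewrite mule_ge0// lee_fin lratio_ge0.
rewrite (ge0_integral_normal _ mg g0) (ge0_integral_normal _ mgl gl0).
by apply: eq_integral => x _; rewrite normal_pdf_lratio EFinM muleA.
Qed.

Local Notation RT := (measurableTypeR R).

Lemma measurable_sub_cst b : measurable_fun setT (fun t : RT => b - t : RT).
Proof. exact: measurable_funB. Qed.

(** The preimage of ]x, y] is [b - y, b - x[, of the same length, and Lebesgue measure is determined
    by its values on the intervals ]x, y]. *)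
Lemma lebesgue_measure_reflect b (A : set R) : measurable A ->
  pushforward leb (fun t : RT => b - t : RT) A = leb A.
Proof.
pose mm := isMeasurableFun.Build _ _ _ _ _ (measurable_sub_cst b).
pose phi : {mfun RT >-> RT} := HB.pack (fun t : RT => b - t : RT) mm.
move=> mA; apply/esym/(@lebesgue_measure_unique R (pushforward leb phi)) => //= _ [[x y]] _ <-.
rewrite /pushforward (_ : _ @^-1` _ = `[b - y, b - x[%classic).
  rewrite !lebesgue_measure_itv/= !lte_fin ltrD2l ltrN2.
  by case: ifP => // _; rewrite -!EFinB; congr EFin; ring.
by apply/seteqP; split => t /=; rewrite !in_itv /= => /andP[? ?]; apply/andP; split; lra.
Qed.

(** The reflection t -> 2a + v - t exchanges a and a + v, hence also the two normal densities. *)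
Lemma ge0_integral_normal_reflect a v g : measurable_fun [set: R] g ->
  (forall x, 0 <= g x)%E ->
  (\int[normal (a + v)]_x g x = \int[normal a]_x g (a + a + v - x)%R)%E.
Proof.
move=> mg g0.
have mr := measurable_sub_cst (a + a + v).
rewrite (ge0_integral_normal _ mg g0).
rewrite (ge0_integral_normal _ (measurableT_comp mg mr) (fun x => g0 _)).
transitivity (\int[pushforward leb (fun t : RT => ((a + a + v) - t)%R : RT)]_x
   (g x * (normal_pdf (a + v) 1 x)%:E))%E.
  by apply: eq_measure_integral => A mA _; exact/esym/lebesgue_measure_reflect.
have mgp : measurable_fun [set: R] (fun x => g x * (normal_pdf (a + v) 1 x)%:E)%E.
  apply: emeasurable_funM mg _.
  by apply/measurable_EFinP; exact: measurable_normal_pdf.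
rewrite (ge0_integral_pushforward mr leb measurableT mgp); last first.
  by move=> x _; rewrite mule_ge0// lee_fin normal_pdf_ge0.
apply: eq_integral => x _; congr (_ * EFin _)%E.
rewrite !normal_pdfE// /normal_fun; congr (_ * expR _).
by rewrite expr1n; field.
Qed.

End GaussianLine.

(** * Finite products of normal laws *)

Section ProductSpace.
Variables (R : realType) (I : eqType).

(** A separate name for I -> R, to which the sigma-algebra generated by the coordinates is
    attached. *)
Definition fspace : Type := I -> R.

HB.instance Definition _ := gen_eqMixin fspace.
HB.instance Definition _ := gen_choiceMixin fspace.
HB.instance Definition _ := isPointed.Build fspace (fun=> 0).

Definition coord_gen : set (set fspace) :=
  \bigcup_(i in [set: I])
    [set (fun x : fspace => x i) @^-1` B | B in (measurable : set (set R))].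

HB.instance Definition _ := @isMeasurable.Build (sigma_display coord_gen)
  fspace <<s coord_gen >> (@sigma_algebra0 _ setT coord_gen)
  (@sigma_algebraC fspace coord_gen) (@sigma_algebra_bigcup _ setT coord_gen).

End ProductSpace.

Section GaussianProduct.
Variables (R : realType) (I : eqType).
Local Notation RT := (measurableTypeR R).
Local Notation normal b := (normal_prob b (1 : R)).
Local Notation prodT := (fspace R I).

Lemma measurable_coord i : measurable_fun [set: prodT] (fun x : prodT => x i : R).
Proof.
move=> _ B mB; rewrite setTI; apply: sub_sigma_algebra.
by exists i => //; exists B.
Qed.

Lemma measurable_to_prodT d (X : measurableType d) (h : X -> prodT) :
  (forall i, measurable_fun [set: X] (fun x => h x i : R)) ->
  measurable_fun [set: X] h.
Proof.
move=> mh; apply: (measurability (coord_gen (R:=R) (I:=I))) => //.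
move=> _ [_ [i _ [B mB <-]] <-].
exact: mh.
Qed.

Definition upd (x : I -> R) (k : I) (t : R) : I -> R :=
  fun j => if j == k then t else x j.

Lemma updE x k t : upd x k t k = t. Proof. by rewrite /upd eqxx. Qed.

Lemma upd_neq x k t j : j != k -> upd x k t j = x j.
Proof. by rewrite /upd => /negbTE ->. Qed.

Lemma upd_upd x k t u : upd (upd x k t) k u = upd x k u.
Proof. by apply/funext => j; rewrite /upd; case: eqP. Qed.

Lemma updC x k l t u : k != l -> upd (upd x k t) l u = upd (upd x l u) k t.
Proof.
move=> kl; apply/funext => j; rewrite /upd.
by have [->|] := eqVneq j l; first by rewrite eq_sym (negbTE kl).
Qed.

Lemma upd_id x k : upd x k (x k) = x.
Proof. by apply/funext => j; rewrite /upd; case: eqP => // ->. Qed.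

Lemma measurable_fun_upd d (X : measurableType d) (h : X -> prodT) k (g : X -> R) :
  measurable_fun [set: X] h -> measurable_fun [set: X] g ->
  measurable_fun [set: X] (fun x => upd (h x) k (g x) : prodT).
Proof.
move=> mh mg; apply: measurable_to_prodT => i; rewrite /upd.
case: eqP => // _; exact: (measurableT_comp (measurable_coord i) mh).
Qed.

Definition updp_fun k (p : RT * prodT) : prodT := upd p.2 k p.1.

Lemma measurable_updp k : measurable_fun [set: RT * prodT] (updp_fun k).
Proof. exact: measurable_fun_upd. Qed.

HB.instance Definition _ k :=
  isMeasurableFun.Build _ _ (RT * prodT)%type prodT (updp_fun k)
    (measurable_updp k).

Definition updp k : {mfun (RT * prodT)%type >-> prodT} := updp_fun k.

(** Built along a list, one coordinate at a time, to mirror [gauss_iter]. The recursion starts at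
    the Dirac mass of the zero function, so coordinates outside the list are 0. *)
Fixpoint gprod (s : seq I) (m : I -> R) : probability prodT R :=
  match s with
  | [::] => dirac (point : prodT)
  | k :: s' => distribution (normal (m k) \x gprod s' m)%E (updp k)
  end.

Lemma gprod_cons k s m : gprod (k :: s) m =
  distribution (normal (m k) \x gprod s m)%E (updp k).
Proof. by reflexivity. Qed.

Lemma eq_gprod s m m' : {in s, m =1 m'} -> gprod s m = gprod s m'.
Proof.
elim: s => [_|k s IH mm']; first by reflexivity.
rewrite !gprod_cons; by rewrite (mm' k) ?mem_head// IH// => j js; apply: mm'; rewrite inE js orbT.
Qed.

Lemma measurable_upd_l (g : prodT -> \bar R) k t :
  measurable_fun [set: prodT] g ->
  measurable_fun [set: prodT] (fun y : prodT => g (upd y k t)).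
Proof.
move=> mg; apply: (measurableT_comp mg); apply: measurable_fun_upd => //.
Qed.

Lemma measurable_upd_r (g : prodT -> \bar R) k y :
  measurable_fun [set: prodT] g ->
  measurable_fun [set: RT] (fun t : RT => g (upd y k t)).
Proof.
by move=> mg; apply: (measurableT_comp mg); apply: measurable_fun_upd.
Qed.

Lemma measurable_updp_comp (g : prodT -> \bar R) k :
  measurable_fun [set: prodT] g ->
  measurable_fun [set: RT * prodT] (fun p => g (updp_fun k p)).
Proof. by move=> mg; exact: (measurableT_comp mg (measurable_updp k)). Qed.

Lemma ge0_integral_gprod_cons k s m (g : prodT -> \bar R) :
  measurable_fun [set: prodT] g -> (forall x, 0 <= g x)%E ->
  (\int[gprod (k :: s) m]_x g x =
   \int[normal (m k)]_t \int[gprod s m]_y g (upd y k t))%E.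
Proof.
move=> mg g0; rewrite gprod_cons (ge0_integral_distribution _ mg g0).
by rewrite (fubini_tonelli1 _ (measurable_updp_comp k mg) (fun=> g0 _)).
Qed.

Lemma gauss_iter_upd s m (g : (I -> R) -> \bar R) k t x : k \notin s ->
  gauss_iter s m g (upd x k t) = gauss_iter s m (fun y => g (upd y k t)) x.
Proof.
elim: s x => //= l s IH x; rewrite inE negb_or => /andP[kl ks].
apply: eq_integral => u _.
rewrite -/(upd (upd x k t) l u) -/(upd x l u) updC// IH//.
Qed.

(** Turns the iterated integral of the statement into an integral against a measure. Without
    repetitions in [s], no integration overwrites a coordinate that an outer one has set. *)
Lemma gauss_iterE s m (g : prodT -> \bar R) : uniq s ->
  measurable_fun [set: prodT] g -> (forall x, 0 <= g x)%E ->
  gauss_iter s m g (fun=> 0) = (\int[gprod s m]_x g x)%E.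
Proof.
elim: s g => [|k s IH] g.
  by move=> _ mg g0; rewrite (integral_dirac _ measurableT mg) diracT mul1e.
rewrite cons_uniq => /andP[ks us] mg g0.
rewrite (ge0_integral_gprod_cons k s m mg g0).
apply: eq_integral => t _.
rewrite -(IH _ us (measurable_upd_l k t mg) (fun=> g0 _)).
exact: (gauss_iter_upd m g t (fun=> 0) ks).
Qed.

Lemma le_gauss_iter s m (g h : prodT -> \bar R) x :
  (forall x, 0 <= g x)%E -> (forall x, g x <= h x)%E ->
  (0 <= gauss_iter s m g x <= gauss_iter s m h x)%E.
Proof.
move=> g0 gh; elim: s x => [|k s IH] x /=; first by rewrite g0 gh.
apply/andP; split; first by apply: integral_ge0 => t _; case/andP: (IH (upd x k t)).
by apply: ge0_le_integral_nomeas => t; case/andP: (IH (upd x k t)).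
Qed.

(** By Tonelli any chosen coordinate can be integrated innermost, so laws that differ in a single
    mean can be compared on lines parallel to one axis. *)
Lemma ge0_integral_gprod_rem s m i (g : prodT -> \bar R) : uniq s -> i \in s ->
  measurable_fun [set: prodT] g -> (forall x, 0 <= g x)%E ->
  (\int[gprod s m]_x g x =
   \int[gprod (rem i s) m]_y \int[normal (m i)]_t g (upd y i t))%E.
Proof.
elim: s g => [//|k s IH] g; rewrite cons_uniq => /andP[ks us] is_ mg g0.
rewrite (ge0_integral_gprod_cons _ _ _ mg g0).
move: is_; rewrite inE; have [<- _|ki is_] := eqVneq i k.
  rewrite rem_cons eqxx.
  exact: (fubini_tonelli (fun p => g (updp_fun i p)) (measurable_updp_comp i mg)).
rewrite rem_cons eq_sym (negbTE ki).
have mh : measurable_fun [set: prodT]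
    (fun y : prodT => \int[normal (m i)]_t g (upd y i t))%E.
  exact: (measurable_fun_fubini_tonelli_G (fun p => g (updp_fun i p)) (measurable_updp_comp i mg)).
rewrite (ge0_integral_gprod_cons _ _ _ mh); last by move=> y; exact: integral_ge0.
apply: eq_integral => t _.
rewrite (IH _ us is_ (measurable_upd_l k t mg) (fun=> g0 _)).
apply: eq_integral => y _; apply: eq_integral => u _.
by rewrite updC.
Qed.

End GaussianProduct.

(** * Square integrable functions on a probability space *)

Section SquareIntegrable.
Context d (T : measurableType d) (R : realType) (P : probability T R).
Implicit Types f g h : T -> R.

Definition int1 f := P.-integrable [set: T] (EFin \o f).
Definition Ex f : R := \int[P]_x f x.
Definition sqint f := measurable_fun [set: T] f /\ int1 (fun x => f x ^+ 2).

Lemma int1_meas f : int1 f -> measurable_fun [set: T] f.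
Proof. by move=> /measurable_int /measurable_EFinP. Qed.

Lemma int1_le f g : measurable_fun [set: T] f -> int1 g ->
  (forall x, `|f x| <= g x) -> int1 f.
Proof.
move=> mf ig fg; apply: (le_integrable measurableT _ _ ig).
  exact/measurable_EFinP.
by move=> x _; rewrite lee_fin (le_trans (fg x))// ler_norm.
Qed.

Lemma int1_cst (c : R) : int1 (fun=> c).
Proof. exact: finite_measure_integrable_cst. Qed.

Lemma int1D f g : int1 f -> int1 g -> int1 (fun x => f x + g x).
Proof. by move=> i1 i2; exact: (integrableD measurableT i1 i2). Qed.

Lemma int1B f g : int1 f -> int1 g -> int1 (fun x => f x - g x).
Proof. by move=> i1 i2; exact: (integrableB measurableT i1 i2). Qed.

Lemma int1Z c f : int1 f -> int1 (fun x => c * f x).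
Proof. by move=> i1; exact: (integrableZl measurableT c i1). Qed.

Lemma ExD f g : int1 f -> int1 g -> Ex (fun x => f x + g x) = Ex f + Ex g.
Proof. by move=> i1 i2; exact: (RintegralD measurableT i1 i2). Qed.

Lemma ExB f g : int1 f -> int1 g -> Ex (fun x => f x - g x) = Ex f - Ex g.
Proof. by move=> i1 i2; exact: (RintegralB measurableT i1 i2). Qed.

Lemma ExZ c f : int1 f -> Ex (fun x => c * f x) = c * Ex f.
Proof. by move=> i1; exact: (RintegralZl c measurableT i1). Qed.

Lemma Ex_cst c : Ex (fun=> c) = c.
Proof.
rewrite /Ex Rintegral_cst//.
rewrite -[RHS]mulr1; congr (_ * _).
by transitivity (fine (P [set: T])) => //; rewrite probability_setT.
Qed.

Lemma Ex_le f g : int1 f -> int1 g -> (forall x, f x <= g x) -> Ex f <= Ex g.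
Proof. by move=> i1 i2 fg; apply: (le_Rintegral measurableT i1 i2) => x _. Qed.

Lemma Ex_ge0_le f (c : R) : 0 <= c -> measurable_fun [set: T] f -> (forall x, 0 <= f x) ->
  (\int[P]_x (f x)%:E <= c%:E)%E -> int1 f /\ Ex f <= c.
Proof.
move=> c0 mf f0 fc; have If : int1 f.
  apply/integrableP; split; first exact/measurable_EFinP.
  apply: le_lt_trans (ltry c); apply: le_trans fc.
  rewrite le_eqVlt; apply/orP; left; apply/eqP.
  by apply: eq_integral => x _ /=; rewrite ger0_norm.
split => //; rewrite -lee_fin; apply: le_trans fc.
rewrite /Ex /Rintegral fineK//.
exact: (integrable_fin_num measurableT If).
Qed.

Lemma Ex_integral f : int1 f -> (\int[P]_x (f x)%:E)%E = (Ex f)%:E.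
Proof.
by move=> If; rewrite /Ex /Rintegral fineK//; exact: (integrable_fin_num measurableT If).
Qed.

(** The two sides, with |a| and |b|, differ by (l|a| - |b|)^2 / (2l). The weight [l] replaces the
    square roots of Cauchy-Schwarz and is chosen at the very end. *)
Lemma mul_le_sq (l a b : R) : 0 < l -> `|a * b| <= l / 2 * a ^+ 2 + (2 * l)^-1 * b ^+ 2.
Proof.
move=> l0; rewrite normrM -(real_normK (num_real a)) -(real_normK (num_real b)).
have := sqr_ge0 (l * `|a| - `|b|).
move: (`|a|) (`|b|) => {}a {}b h.
have -> : l / 2 * a ^+ 2 + (2 * l)^-1 * b ^+ 2 =
  a * b + (2 * l)^-1 * (l * a - b) ^+ 2 by field; rewrite gt_eqF.
by rewrite lerDl mulr_ge0// invr_ge0 mulr_ge0// ltW.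
Qed.

Lemma sqint_mul f g : sqint f -> sqint g -> int1 (fun x => f x * g x).
Proof.
move=> [mf i1] [mg i2]; apply: (@int1_le _ (fun x => (1 / 2 * f x ^+ 2 + (2 * 1)^-1 * g x ^+ 2))).
- exact: measurable_funM.
- by apply: int1D; exact: int1Z.
- by move=> x; exact: mul_le_sq.
Qed.

Lemma sqint_cst (c : R) : sqint (fun=> c).
Proof. by split => //; exact: int1_cst. Qed.

Lemma sqint_int1 f : sqint f -> int1 f.
Proof.
move=> sf; have := sqint_mul sf (sqint_cst 1).
by congr (int1 _); apply/funext => x; rewrite mulr1.
Qed.

Lemma sqintD f g : sqint f -> sqint g -> sqint (fun x => f x + g x).
Proof.
move=> sf sg; split; first exact: measurable_funD sf.1 sg.1.
have -> : (fun x => (f x + g x) ^+ 2) = (fun x => f x ^+ 2 + (2 * (f x * g x) + g x ^+ 2)).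
  by apply/funext => x; ring.
apply: int1D sf.2 (int1D _ sg.2).
exact/int1Z/sqint_mul.
Qed.

Lemma sqintZ c f : sqint f -> sqint (fun x => c * f x).
Proof.
move=> [mf i1]; split; first exact: measurable_funM.
have -> : (fun x => (c * f x) ^+ 2) = (fun x => c ^+ 2 * f x ^+ 2).
  by apply/funext => x; rewrite exprMn.
exact: int1Z.
Qed.

Lemma sqintB f g : sqint f -> sqint g -> sqint (fun x => f x - g x).
Proof.
move=> sf sg; have := sqintD sf (sqintZ (-1) sg).
by congr sqint; apply/funext => x; rewrite mulN1r.
Qed.

Lemma Ex_mul_le (l : R) f g : 0 < l -> sqint f -> sqint g ->
  Ex (fun x => f x * g x) <=
    l / 2 * Ex (fun x => f x ^+ 2) + (2 * l)^-1 * Ex (fun x => g x ^+ 2).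
Proof.
move=> l0 sf sg.
rewrite -ExZ; last exact: sf.2.
rewrite -ExZ; last exact: sg.2.
rewrite -ExD; [|exact: int1Z sf.2|exact: int1Z sg.2].
apply: Ex_le (sqint_mul sf sg) _ _; first by apply: int1D; apply: int1Z; [exact: sf.2|exact: sg.2].
by move=> x; apply: le_trans (mul_le_sq _ _ l0); rewrite ler_norm.
Qed.

End SquareIntegrable.

(** * Change of measure and of variables *)

Section Transfer.
Context d (T : measurableType d) (R : realType) (P Q : probability T R).
Variables (phi : T -> T) (w : T -> R).
Hypothesis mphi : measurable_fun [set: T] phi.
Hypothesis mw : measurable_fun [set: T] w.
Hypothesis w0 : forall x, 0 <= w x.
(** [Q] is the image under [phi] of the measure with density [w] with respect to [P]. Shifts take
    [phi] to be the identity, reflections take [w] to be 1. *)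
Hypothesis PQ : forall g : T -> \bar R, measurable_fun [set: T] g ->
  (forall x, 0 <= g x)%E -> (\int[Q]_x g x = \int[P]_x (g (phi x) * (w x)%:E))%E.

Lemma int1_transfer f : measurable_fun [set: T] f ->
  int1 Q f <-> int1 P (fun x => f (phi x) * w x).
Proof.
move=> mf.
have mf' : measurable_fun [set: T] (fun x => f (phi x) * w x).
  by apply: measurable_funM => //; exact: (measurableT_comp mf mphi).
have mnf : measurable_fun [set: T] (fun x => `|f x|%:E).
  by apply/measurable_EFinP; exact: measurableT_comp.
have nf0 x : (0 <= `|f x|%:E)%E by rewrite lee_fin.
have eqi : (\int[Q]_x `|(f x)%:E| = \int[P]_x `|(f (phi x) * w x)%:E|)%E.
  rewrite (PQ mnf nf0); apply: eq_integral => x _ /=.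
  by rewrite normrM EFinM (ger0_norm (w0 x)).
split=> /integrableP[_ fin]; apply/integrableP; split; try exact/measurable_EFinP.
- by rewrite -eqi.
- by rewrite eqi.
Qed.

Lemma Ex_transfer f : measurable_fun [set: T] f ->
  Ex Q f = Ex P (fun x => f (phi x) * w x).
Proof.
move=> mf; rewrite /Ex /Rintegral; congr fine.
have mE : measurable_fun [set: T] (fun x => (f x)%:E) by exact/measurable_EFinP.
rewrite integralE [RHS]integralE.
congr (_ - _)%E.
- rewrite (PQ (measurable_funepos mE) (fun x => funepos_ge0 _ x)).
  apply: eq_integral => x _; rewrite !funeposE.
  by rewrite -!EFin_max -EFinM maxr_pMl// mul0r.
- rewrite (PQ (measurable_funeneg mE) (fun x => funeneg_ge0 _ x)).
  apply: eq_integral => x _; rewrite !funenegE.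
  by rewrite -!EFin_max -EFinM maxr_pMl// mul0r mulNr.
Qed.

End Transfer.

(** * Shifts and reflections of Gaussian vectors *)

Section GaussianVector.
Variables (R : realType) (I : finType).
Local Notation RT := (measurableTypeR R).
Local Notation normal b := (normal_prob b (1 : R)).
Local Notation prodT := (fspace R I).
Implicit Types (m a b : I -> R) (i : I) (v : R).

Definition gauss m : probability prodT R := gprod (index_enum I) m.

(** Once coordinate [i] is integrated innermost, the other coordinates have the same law on both
    sides, so an identity on each line in direction [i] suffices. *)
Lemma gauss_coord m i c (g h : prodT -> \bar R) :
  measurable_fun [set: prodT] g -> (forall x, 0 <= g x)%E ->
  measurable_fun [set: prodT] h -> (forall x, 0 <= h x)%E ->
  (forall y, \int[normal c]_t g (upd y i t) =
             \int[normal (m i)]_t h (upd y i t))%E ->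
  (\int[gauss (upd m i c)]_x g x = \int[gauss m]_x h x)%E.
Proof.
move=> mg g0 mh h0 gh; rewrite /gauss.
have ue : uniq (index_enum I) := index_enum_uniq I.
have ie : i \in index_enum I := mem_index_enum i.
rewrite (ge0_integral_gprod_rem _ ue ie mg g0) (ge0_integral_gprod_rem _ ue ie mh h0).
rewrite updE (@eq_gprod _ _ _ (upd m i c) m); last first.
  by move=> j; rewrite mem_rem_uniq// inE => /andP[ji _]; rewrite upd_neq.
by apply: eq_integral => y _; exact: gh.
Qed.

Lemma measurable_lratio_coord v c i :
  measurable_fun [set: prodT] (fun x : prodT => lratio v c (x i)).
Proof. exact: (measurableT_comp (measurable_lratio v c) (measurable_coord i)). Qed.

Lemma gauss_shift m i v (g : prodT -> \bar R) :
  measurable_fun [set: prodT] g -> (forall x, 0 <= g x)%E ->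
  (\int[gauss (upd m i (m i + v))]_x g x =
   \int[gauss m]_x (g x * (lratio v (m i) (x i))%:E))%E.
Proof.
move=> mg g0; apply: (gauss_coord mg g0).
- apply: (emeasurable_funM mg); apply/measurable_EFinP.
  exact: measurable_lratio_coord.
- by move=> x; rewrite mule_ge0// lee_fin lratio_ge0.
- move=> y; rewrite (ge0_integral_normal_shift v (m i) (measurable_upd_r i y mg) (fun=> g0 _)).
  by apply: eq_integral => t _; rewrite updE.
Qed.

Definition refl m i v (x : prodT) : prodT := upd x i (m i + m i + v - x i).

Lemma measurable_refl m i v : measurable_fun [set: prodT] (refl m i v).
Proof.
apply: measurable_fun_upd => //; apply: measurable_funB => //.
exact: measurable_coord.
Qed.

Lemma gauss_refl m i v (g : prodT -> \bar R) :
  measurable_fun [set: prodT] g -> (forall x, 0 <= g x)%E ->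
  (\int[gauss (upd m i (m i + v))]_x g x = \int[gauss m]_x g (refl m i v x))%E.
Proof.
move=> mg g0; apply: (gauss_coord mg g0).
- exact: (measurableT_comp mg (measurable_refl _ _ _)).
- by move=> x; exact: g0.
- move=> y; rewrite (ge0_integral_normal_reflect (m i) v (measurable_upd_r i y mg) (fun=> g0 _)).
  by apply: eq_integral => t _; rewrite /refl updE upd_upd.
Qed.

Lemma gauss_indep m i c (g : prodT -> \bar R) :
  measurable_fun [set: prodT] g -> (forall x, 0 <= g x)%E ->
  (forall y t, g (upd y i t) = g y) ->
  (\int[gauss (upd m i c)]_x g x = \int[gauss m]_x g x)%E.
Proof.
move=> mg g0 gi; apply: (gauss_coord mg g0 mg g0) => y.
have constint (z : R) : (\int[normal z]_t g (upd y i t) = g y)%E.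
  under eq_integral do rewrite gi.
  rewrite (integral_cst (normal z) measurableT).
  transitivity (g y * normal z [set: _])%E; first by [].
  by rewrite probability_setT mule1.
by rewrite !constint.
Qed.

(** Truncating a shift to a list lets it be applied one coordinate at a time, by induction on the
    list. Later it also describes a sweep that is only partly done. *)
Definition restr (s : seq I) a : I -> R := fun i => if i \in s then a i else 0.

Lemma addr_restr_cons s m a k : k \notin s ->
  (fun i => m i + restr (k :: s) a i) =
  upd (fun i => m i + restr s a i) k (m k + restr s a k + a k).
Proof.
move=> ks; apply/funext => i; rewrite /restr /upd inE.
by have [->|//] := eqVneq i k; rewrite (negbTE ks) addr0.
Qed.

Lemma restr_enum a : restr (index_enum I) a = a.
Proof. by apply/funext => i; rewrite /restr mem_index_enum. Qed.

Lemma restr_nil m a : (fun i => m i + restr [::] a i) = m.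
Proof. by apply/funext => i; rewrite addr0. Qed.

(** The density Lambda_a; see [gauss_cameron_martin]. *)
Definition glratio m a (x : prodT) : R := \prod_i lratio (a i) (m i) (x i).

Lemma glratio_ge0 m a x : 0 <= glratio m a x.
Proof. by apply: prodr_ge0 => i _; exact: lratio_ge0. Qed.

Lemma measurable_prod_lratio (s : seq I) m a :
  measurable_fun [set: prodT] (fun x : prodT => \prod_(i <- s) lratio (a i) (m i) (x i)).
Proof.
elim: s => [|k s IH].
  have -> : (fun x : prodT => \prod_(i <- [::]) lratio (a i) (m i) (x i)) = cst 1.
    by apply/funext => x; rewrite big_nil.
  exact: measurable_cst.
under eq_fun do rewrite big_cons.
by apply: measurable_funM IH; exact: measurable_lratio_coord.
Qed.

Lemma measurable_glratio m a : measurable_fun [set: prodT] (glratio m a).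
Proof. exact: measurable_prod_lratio. Qed.

Lemma gauss_cameron_martin m a (g : prodT -> \bar R) :
  measurable_fun [set: prodT] g -> (forall x, 0 <= g x)%E ->
  (\int[gauss (fun i => m i + a i)%R]_x g x =
   \int[gauss m]_x (g x * (glratio m a x)%:E))%E.
Proof.
rewrite /glratio -[in LHS](restr_enum a).
have := index_enum_uniq I; elim: (index_enum I) g => [|k s IH] g.
  move=> _ mg g0; rewrite restr_nil.
  by apply: eq_integral => x _; rewrite big_nil mule1.
rewrite cons_uniq => /andP[ks us] mg g0; rewrite (addr_restr_cons _ _ ks).
have mk : m k + restr s a k = m k by rewrite /restr (negbTE ks) addr0.
rewrite (@gauss_shift (fun i => m i + restr s a i) k (a k) _ mg g0) /= IH.
- by apply: eq_integral => x _; rewrite mk big_cons EFinM muleA.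
- exact: us.
- apply: (emeasurable_funM mg); apply/measurable_EFinP.
  exact: measurable_lratio_coord.
- by move=> x; rewrite mule_ge0// lee_fin lratio_ge0.
Qed.

Lemma gauss_indep_shift m a (g : prodT -> \bar R) :
  measurable_fun [set: prodT] g -> (forall x, 0 <= g x)%E ->
  (forall i y t, a i != 0 -> g (upd y i t) = g y) ->
  (\int[gauss (fun i => m i + a i)%R]_x g x = \int[gauss m]_x g x)%E.
Proof.
rewrite -[in X in X = _](restr_enum a) => mg g0 ga.
have := index_enum_uniq I; elim: (index_enum I) => [|k s IH].
  by rewrite restr_nil.
rewrite cons_uniq => /andP[ks us]; rewrite (addr_restr_cons _ _ ks) -(IH us).
have [ak0|ak0] := eqVneq (a k) 0.
  by rewrite ak0 addr0 upd_id.
by apply: (gauss_indep _ _ mg g0) => y t; exact: ga.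
Qed.

Lemma lratioM v w c t :
  lratio v c t * lratio w c t = expR (v * w) * lratio (v + w) c t.
Proof. by rewrite /lratio -!expRD; congr expR; field. Qed.

Lemma glratioM m a b x :
  glratio m a x * glratio m b x =
  expR (\sum_i a i * b i) * glratio m (fun i => a i + b i) x.
Proof.
rewrite /glratio -big_split /= expR_sum -big_split /=.
by apply: eq_bigr => i _; exact: lratioM.
Qed.

Lemma integral_glratio m a : (\int[gauss m]_x (glratio m a x)%:E = 1)%E.
Proof.
have m1 : measurable_fun [set: prodT] (cst 1%E : prodT -> \bar R) by exact: measurable_cst.
have := @gauss_cameron_martin m a _ m1 (fun=> lee01).
rewrite (integral_cst (gauss (fun i => m i + a i)) measurableT) mul1e.
move=> h; transitivity (gauss (fun i => m i + a i)%R [set: _]); last exact: probability_setT.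
rewrite [RHS]h; by apply: eq_integral => x _; rewrite mul1e.
Qed.

Local Notation E m := (Ex (gauss m)).

Lemma int1_glratio m a : int1 (gauss m) (glratio m a) /\ E m (glratio m a) = 1.
Proof.
have [] := @Ex_ge0_le _ _ _ (gauss m) (glratio m a) 1 ler01 (measurable_glratio m a) (glratio_ge0 m a).
  by rewrite integral_glratio.
move=> i1 _; split => //.
by apply: EFin_inj; rewrite -(Ex_integral i1) integral_glratio.
Qed.

Lemma sqint_glratio m a : sqint (gauss m) (glratio m a).
Proof.
split; first exact: measurable_glratio.
have -> : (fun x => glratio m a x ^+ 2) =
  (fun x => expR (\sum_i a i * a i) * glratio m (fun i => a i + a i) x).
  by apply/funext => x; rewrite expr2 glratioM.
by apply: int1Z; exact: (int1_glratio _ _).1.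
Qed.

Lemma Ex_glratioM m a b :
  E m (fun x => glratio m a x * glratio m b x) = expR (\sum_i a i * b i).
Proof.
have -> : (fun x => glratio m a x * glratio m b x) =
  (fun x => expR (\sum_i a i * b i) * glratio m (fun i => a i + b i) x).
  by apply/funext => x; rewrite glratioM.
rewrite ExZ; last exact: (int1_glratio _ _).1.
by rewrite (int1_glratio _ _).2 mulr1.
Qed.

(** The hypothesis says that each a_i is 0 or b_i. Then <a, b> = |a|^2, and the squared distance
    becomes a plain difference, which telescopes along growing shifts. *)
Lemma Ex_glratio_dist m a b : (forall i, a i * b i = a i * a i) ->
  E m (fun x => (glratio m b x - glratio m a x) ^+ 2) =
  expR (\sum_i b i * b i) - expR (\sum_i a i * a i).
Proof.
move=> ab.
have -> : (fun x => (glratio m b x - glratio m a x) ^+ 2) =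
  (fun x => (glratio m b x * glratio m b x + glratio m a x * glratio m a x)
     - 2 * (glratio m a x * glratio m b x)).
  by apply/funext => x; ring.
have sM c e : int1 (gauss m) (fun x => glratio m c x * glratio m e x).
  by apply: sqint_mul; exact: sqint_glratio.
rewrite (ExB (int1D (sM _ _) (sM _ _)) (int1Z _ (sM _ _))).
rewrite (ExD (sM _ _) (sM _ _)) (ExZ _ (sM _ _)) !Ex_glratioM (eq_bigr _ (fun i _ => ab i)).
by ring.
Qed.

Lemma Ex_shift m a (f : prodT -> R) : measurable_fun [set: prodT] f ->
  E (fun i => m i + a i) f = E m (fun x => f x * glratio m a x).
Proof.
move=> mf.
exact: (Ex_transfer (phi := id) (glratio_ge0 m a) (@gauss_cameron_martin m a) mf).
Qed.

Lemma int1_shift m a (f : prodT -> R) : measurable_fun [set: prodT] f ->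
  int1 (gauss (fun i => m i + a i)) f <->
  int1 (gauss m) (fun x => f x * glratio m a x).
Proof.
move=> mf; apply: (int1_transfer (phi := id) _ _ _ _ mf).
- exact: measurable_id.
- exact: measurable_glratio.
- exact: glratio_ge0.
- exact: gauss_cameron_martin.
Qed.

Lemma sqint_int1_shift m a (f : prodT -> R) : sqint (gauss m) f ->
  int1 (gauss (fun i => m i + a i)) f.
Proof.
move=> sf; apply/int1_shift; first exact: sf.1.
exact: sqint_mul sf (sqint_glratio _ _).
Qed.

Lemma Ex_indep_shift m a (f : prodT -> R) : measurable_fun [set: prodT] f ->
  (forall i y t, a i != 0 -> f (upd y i t) = f y) ->
  E (fun i => m i + a i) f = E m f.
Proof.
move=> mf fa; rewrite /Ex /Rintegral; congr fine.
have mE : measurable_fun [set: prodT] (fun x => (f x)%:E) by exact/measurable_EFinP.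
rewrite integralE [RHS]integralE.
congr (_ - _)%E; apply: gauss_indep_shift.
- exact: measurable_funepos.
- by move=> x; exact: funepos_ge0.
- by move=> i y t ai; rewrite !funeposE fa.
- exact: measurable_funeneg.
- by move=> x; exact: funeneg_ge0.
- by move=> i y t ai; rewrite !funenegE fa.
Qed.

(* [refl_prob] is the probability that the reflection coupling of N(c, 1) and
   N(c + v, 1) moves the point t, to its mirror image 2c + v - t. *)
Definition refl_prob v c t : R := Num.max 0 (1 - lratio v c t).

Lemma refl_prob_ge0 v c t : 0 <= refl_prob v c t. Proof. by rewrite le_max lexx. Qed.

Lemma refl_prob_le1 v c t : refl_prob v c t <= 1.
Proof. by rewrite ge_max ler01 gerBl lratio_ge0. Qed.

Lemma measurable_refl_prob v c i : measurable_fun [set: prodT] (fun x : prodT => refl_prob v c (x i)).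
Proof.
apply: measurable_maxr => //; apply: measurable_funB => //.
exact: measurable_lratio_coord.
Qed.

Lemma lratio_refl v c t : lratio v c (c + c + v - t) * lratio v c t = 1.
Proof. by rewrite /lratio -expRD -[RHS]expR0; congr expR; field. Qed.

(** Both sides equal min(1, [lratio v c t]), because the ratios at mirror points are inverse to each
    other: the mass that stays is the minimum of the two densities. *)
Lemma refl_prob_mirror v c t : (1 - refl_prob v c (c + c + v - t)) * lratio v c t = 1 - refl_prob v c t.
Proof.
have h := lratio_refl v c t; have l0 : 0 <= lratio v c t := lratio_ge0 v c t.
rewrite /refl_prob; move: h l0.
move: (lratio v c (c + c + v - t)) (lratio v c t) => p q pq q0.
have [p1|p1] := leP 0 (1 - p); have [q1|q1] := leP 0 (1 - q).
- have := mulr_ge0 p1 q0; lra.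
- lra.
- lra.
- have : 0 <= (p - 1) * q by rewrite mulr_ge0//; lra.
  lra.
Qed.

(** The product is the positive part of [lratio v c t - 1]: the mass arriving by jumps is the excess
    of the new density over the old one. *)
Lemma refl_prob_mirror_le v c t :
  0 <= refl_prob v c (c + c + v - t) * lratio v c t <= `|lratio v c t - 1|.
Proof.
rewrite mulr_ge0 ?refl_prob_ge0 ?lratio_ge0//=.
have := refl_prob_mirror v c t; rewrite mulrBl mul1r => /eqP; rewrite subr_eq => /eqP e.
have -> : refl_prob v c (c + c + v - t) * lratio v c t = lratio v c t - 1 + refl_prob v c t by lra.
rewrite {e} /refl_prob; have := ler_norm (lratio v c t - 1).
have := normr_ge0 (lratio v c t - 1).
by have [q1|q1] := leP 0 (1 - lratio v c t); lra.
Qed.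

Lemma Ex_refl m i v (f : prodT -> R) : measurable_fun [set: prodT] f ->
  E (upd m i (m i + v)) f = E m (fun x => f (refl m i v x)).
Proof.
move=> mf; rewrite (Ex_transfer (P := gauss m) (phi := refl m i v) (w := fun=> 1) _ _ mf); last 2 first.
- by move=> x; exact: ler01.
- by move=> g mg g0; rewrite (gauss_refl _ _ _ mg g0); apply: eq_integral => x _; rewrite mule1.
by congr Ex; apply/funext => x; rewrite mulr1.
Qed.

Lemma int1_refl m i v (f : prodT -> R) : measurable_fun [set: prodT] f ->
  int1 (gauss (upd m i (m i + v))) f <-> int1 (gauss m) (fun x => f (refl m i v x)).
Proof.
move=> mf; have m1 : measurable_fun [set: prodT] (cst 1 : prodT -> R) by exact: measurable_cst.
have := int1_transfer (P := gauss m) (Q := gauss (upd m i (m i + v)))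
  (phi := refl m i v) (w := fun=> 1) (measurable_refl m i v) m1 _ _ mf.
move=> ->.
- by have -> : (fun x => f (refl m i v x) * 1) = (fun x => f (refl m i v x)) by
    apply/funext => x; rewrite mulr1.
- by move=> x; exact: ler01.
- by move=> g mg g0; rewrite (gauss_refl _ _ _ mg g0); apply: eq_integral => x _; rewrite mule1.
Qed.

Lemma upd_shift m i v : upd m i (m i + v) =
  (fun j => m j + (if j == i then v else 0)).
Proof.
by apply/funext => j; rewrite /upd; have [->|] := eqVneq j i; rewrite ?addr0.
Qed.

Lemma glratio1 m i v x :
  glratio m (fun j => if j == i then v else 0) x = lratio v (m i) (x i).
Proof.
rewrite /glratio (bigD1 i)//= eqxx big1 ?mulr1// => j /negbTE ->.
by rewrite /lratio mul0r expr0n mul0r subr0 expR0.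
Qed.

Lemma reflection_coupling m i v (g : prodT -> R) :
  int1 (gauss (upd m i (m i + v))) g ->
  [/\ int1 (gauss m) (fun x => (1 - refl_prob v (m i) (x i)) * g x),
      int1 (gauss m) (fun x => refl_prob v (m i) (x i) * g (refl m i v x)) &
      E m (fun x => (1 - refl_prob v (m i) (x i)) * g x) +
      E m (fun x => refl_prob v (m i) (x i) * g (refl m i v x)) =
      E (upd m i (m i + v)) g].
Proof.
move=> ig; have mg := int1_meas ig.
(* [rr] reads the coupling from its endpoint: under the shifted law a point has arrived by
   reflection with probability [rr] and has stayed with probability 1 - [rr]. *)
pose rr (x : prodT) := refl_prob v (m i) (m i + m i + v - x i).
have mrr : measurable_fun [set: prodT] rr.
  apply: measurable_maxr => //; apply: measurable_funB => //.
  apply: (measurableT_comp (measurable_lratio v (m i))).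
  by apply: measurable_funB => //; exact: measurable_coord.
have rrr x : rr (refl m i v x) = refl_prob v (m i) (x i).
  by rewrite /rr /refl updE; congr refl_prob; ring.
have mrg : measurable_fun [set: prodT] (fun x => rr x * g x) by exact: measurable_funM.
have msg : measurable_fun [set: prodT] (fun x => (1 - rr x) * g x).
  by apply: measurable_funM => //; exact: measurable_funB.
have irg : int1 (gauss (upd m i (m i + v))) (fun x => rr x * g x).
  apply: (int1_le mrg (integrable_norm ig)) => x.
  by rewrite normrM ger0_norm ?refl_prob_ge0// ler_piMl// refl_prob_le1.
have isg : int1 (gauss (upd m i (m i + v))) (fun x => (1 - rr x) * g x).
  have := int1B ig irg; congr int1; apply/funext => x; by rewrite mulrBl mul1r.
have e1 : (fun x => refl_prob v (m i) (x i) * g (refl m i v x)) =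
          (fun x => rr (refl m i v x) * g (refl m i v x)).
  by apply/funext => x; rewrite rrr.
have e2 : (fun x => (1 - refl_prob v (m i) (x i)) * g x) =
    (fun x => ((1 - rr x) * g x) * glratio m (fun j => if j == i then v else 0) x).
  apply/funext => x; rewrite glratio1 -(refl_prob_mirror v (m i) (x i)) [LHS]mulrAC; reflexivity.
rewrite e1 e2; split.
- by apply/(int1_shift _ _ msg); rewrite -upd_shift.
- exact/(int1_refl _ _ _ mrg).
- rewrite -(Ex_shift _ _ msg) -upd_shift -(Ex_refl _ _ _ mrg) -ExD//.
  by congr Ex; apply/funext => x; ring.
Qed.

End GaussianVector.

(** * The reflection walk *)

Section CoordinateReach.
Variables (R : realType) (I : eqType).

Inductive reach : nat -> (I -> R) -> (I -> R) -> Prop :=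
| reach0 j x : reach j x x
| reachS j x i t y : reach j (upd x i t) y -> reach j.+1 x y.

Lemma reach_le j k x y : (j <= k)%N -> reach j x y -> reach k x y.
Proof.
move=> jk r; elim: r k jk => [j' x' k _|j' x' i t y' r IH [//|k] jk].
  exact: reach0.
by apply: (reachS (i := i) (t := t)); exact: IH.
Qed.

End CoordinateReach.

Section Walk.
Variables (R : realType) (I : finType) (v : R) (f : fspace R I -> R).
Local Notation prodT := (fspace R I).
Local Notation E m := (Ex (gauss m)).
Hypothesis mf : measurable_fun [set: prodT] f.
Implicit Types (m : I -> R) (l : seq I) (x : prodT).

(* The conditional expectation of f at the end of a walk that runs the
   reflection couplings along the coordinates l, one after the other, and
   stops at its j-th jump. *)
Fixpoint walk l m (j : nat) x : R :=
  match l with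
  | [::] => f x
  | i :: l' =>
    match j with
    | 0%N => f x
    | j'.+1 => (1 - refl_prob v (m i) (x i)) * walk l' (upd m i (m i + v)) j x +
               refl_prob v (m i) (x i) * walk l' (upd m i (m i + v)) j' (refl m i v x)
    end
  end.

Lemma walk0 l m x : walk l m 0 x = f x. Proof. by case: l. Qed.

Lemma measurable_walk l m j : measurable_fun [set: prodT] (walk l m j).
Proof.
elim: l m j => [//|i l IH] m [//|j].
apply: measurable_funD; apply: measurable_funM.
- by apply: measurable_funB; [exact: measurable_cst|exact: measurable_refl_prob].
- exact: IH.
- exact: measurable_refl_prob.
- exact: (measurableT_comp (IH _ j) (measurable_refl _ _ _)).
Qed.

(** The walk averages [f] over points reachable from [x] in [j] updates. The centre [c] is kept
    separate from [f x] because the starting point moves in the induction. *)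
Lemma walk_dist l m j x (c D : R) :
  (forall y, reach j x y -> `|f y - c| <= D) -> `|walk l m j x - c| <= D.
Proof.
elim: l m j x => [m j x fD|i l IH m [|j] x fD].
- exact/fD/reach0.
- exact/fD/reach0.
- set m' := upd m i (m i + v); set r := refl_prob v (m i) (x i).
  have h1 : `|walk l m' j.+1 x - c| <= D by exact: IH.
  have h2 : `|walk l m' j (refl m i v x) - c| <= D.
    by apply: IH => y ry; apply: fD; apply: reachS ry.
  have r0 : 0 <= r by exact: refl_prob_ge0.
  have r1 : r <= 1 by exact: refl_prob_le1.
  have -> : walk (i :: l) m j.+1 x - c =
    (1 - r) * (walk l m' j.+1 x - c) + r * (walk l m' j (refl m i v x) - c).
    by rewrite /= -/m' -/r; ring.
  apply: le_trans (ler_normD _ _) _.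
  rewrite !normrM (ger0_norm r0) (@ger0_norm _ (1 - r)) ?subr_ge0//.
  have -> : D = (1 - r) * D + r * D by ring.
  by apply: lerD; apply: ler_wpM2l; rewrite // subr_ge0.
Qed.

Variable k : nat.

Definition potential l m : R := \sum_(j < k) E m (walk l m j.+1).

(** By the coupling, the new mean of the walk with j + 1 jumps has jump part [A j.+1]. In the old
    mean one jump is already spent, so its jump part is [A j], while the staying parts agree. The
    sum telescopes to [A k - A 0], and a walk with no jump left is [f]. *)
Lemma potential_step i l m : (forall j, (j <= k)%N ->
    int1 (gauss (upd m i (m i + v))) (walk l (upd m i (m i + v)) j)) ->
  potential l (upd m i (m i + v)) = potential (i :: l) m +
  E m (fun x => refl_prob v (m i) (x i) *
     (walk l (upd m i (m i + v)) k (refl m i v x) - f (refl m i v x))).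
Proof.
set m' := upd m i (m i + v) => iW.
pose A j := E m (fun x => refl_prob v (m i) (x i) * walk l m' j (refl m i v x)).
have stepj j : (j < k)%N ->
    E m (walk (i :: l) m j.+1) = E m' (walk l m' j.+1) - (A j.+1 - A j).
  move=> jk; have [i1 i2 e1] := reflection_coupling (iW j.+1 jk).
  have [_ i3 _] := reflection_coupling (iW j (ltnW jk)).
  rewrite -/m' in i2 i3 e1.
  transitivity (E m (fun x => (1 - refl_prob v (m i) (x i)) * walk l m' j.+1 x) + A j).
    by rewrite -ExD.
  by rewrite -/m' -e1 /A; ring.
have -> : potential (i :: l) m = potential l m' - (A k - A 0%N).
  rewrite /potential (eq_bigr (fun j : 'I_k => E m' (walk l m' j.+1) - (A j.+1 - A j))).
    by rewrite sumrB -(big_mkord xpredT (fun j => A j.+1 - A j)) telescope_sumr.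
  by move=> j _; exact: stepj.
have [_ ik _] := reflection_coupling (iW k (leqnn k)).
have [_ i0 _] := reflection_coupling (iW 0%N (leq0n k)).
have -> : (fun x => refl_prob v (m i) (x i) * (walk l m' k (refl m i v x) - f (refl m i v x))) =
  (fun x => refl_prob v (m i) (x i) * walk l m' k (refl m i v x) -
            refl_prob v (m i) (x i) * walk l m' 0 (refl m i v x)).
  by apply/funext => x; rewrite walk0 mulrBr.
by rewrite ExB// -/(A k) -/(A 0%N); ring.
Qed.

Variables (P : pred I) (M : R).
Hypothesis M0 : 0 < M.

(** The mean vector after [s] complete sweeps over the coordinates in [P]. *)
Definition base (s : nat) : I -> R := fun i => if P i then s%:R * v else 0.

Hypothesis f_sqint : forall s, sqint (gauss (base s)) f.
(** The premise on [h] says that |h| is at most the largest change of [f] under [k] updates, without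
    naming that supremum, which may be infinite or not measurable. *)
Hypothesis f_sens : forall s (h : prodT -> R), measurable_fun [set: prodT] h ->
  (forall x (D : R), (forall y, reach k x y -> `|f y - f x| <= D) -> `|h x| <= D) ->
  int1 (gauss (base s)) (fun x => h x ^+ 2) /\
  E (base s) (fun x => h x ^+ 2) <= M ^+ 2.

Local Notation mid s p := (fun i => base s i + restr p (fun=> v) i).

Lemma sum_restr_sq (p : seq I) : uniq p ->
  \sum_i restr p (fun=> v) i * restr p (fun=> v) i = (size p)%:R * v ^+ 2.
Proof.
move=> up; rewrite (eq_bigr (fun i => if i \in p then v ^+ 2 else 0)); last first.
  by move=> i _; rewrite /restr; case: ifP => _; rewrite ?mulr0 ?expr2.
rewrite -big_mkcond /= sumr_const (card_uniqP up).
by rewrite mulr_natl.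
Qed.

Lemma glratio_cons m (a : I -> R) p i x : i \notin p ->
  glratio m (restr (i :: p) a) x = glratio m (restr p a) x * lratio (a i) (m i) (x i).
Proof.
move=> ip; rewrite /glratio (bigD1 i)//= [in RHS](bigD1 i)//=.
rewrite {1}/restr mem_head {2}/restr (negbTE ip).
have -> : lratio 0 (m i) (x i) = 1 by rewrite /lratio mul0r expr0n mul0r subr0 expR0.
rewrite mul1r mulrC; congr (_ * _); apply: eq_bigr => j ji.
by rewrite /restr inE (negbTE ji).
Qed.

Lemma walk_sqint s l m j : (j <= k)%N ->
  [/\ sqint (gauss (base s)) (walk l m j),
   sqint (gauss (base s)) (fun x => walk l m j x - f x) &
   E (base s) (fun x => (walk l m j x - f x) ^+ 2) <= M ^+ 2].
Proof.
move=> jk.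
have mh : measurable_fun [set: prodT] (fun x => walk l m j x - f x).
  by apply: measurable_funB; [exact: measurable_walk|exact: mf].
have [i1 EM] : int1 (gauss (base s)) (fun x => (walk l m j x - f x) ^+ 2) /\
    E (base s) (fun x => (walk l m j x - f x) ^+ 2) <= M ^+ 2.
  apply: f_sens => // x D fD; apply: walk_dist => y ry; apply: fD.
  exact: reach_le ry.
split => //.
have := sqintD (conj mh i1) (f_sqint s).
by congr sqint; apply/funext => x; rewrite subrK.
Qed.

(** The jump term lives under a law in the middle of a sweep, while [M] controls [h] under [base s].
    Undoing the reflection and passing to densities yields a mean under [base s] of [h] against a
    weight of size at most |La - Lb|, whose squared norm is the difference of exponentials. *)
Lemma step_bound s p i (h : prodT -> R) (L : R) : 0 < L -> i \notin p ->
  uniq p -> sqint (gauss (base s)) h -> E (base s) (fun x => h x ^+ 2) <= M ^+ 2 ->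
  E (mid s p) (fun x => refl_prob v (mid s p i) (x i) * h (refl (mid s p) i v x)) <=
  L / 2 * M ^+ 2 + (2 * L)^-1 *
    (expR ((size p).+1%:R * v ^+ 2) - expR ((size p)%:R * v ^+ 2)).
Proof.
move=> L0 ip up sh hM.
have mpi : mid s p i = base s i by rewrite /restr (negbTE ip) addr0.
set c := base s i.
pose g x := refl_prob v c (c + c + v - x i) * h x.
have mg : measurable_fun [set: prodT] g.
  apply: measurable_funM sh.1; apply: measurable_maxr => //; apply: measurable_funB => //.
  apply: (measurableT_comp (measurable_lratio v c)).
  by apply: measurable_funB => //; exact: measurable_coord.
have -> : (fun x => refl_prob v (mid s p i) (x i) * h (refl (mid s p) i v x)) =
          (fun x => g (refl (mid s p) i v x)).
  apply/funext => x; rewrite /g /refl updE mpi; congr (refl_prob _ _ _ * _).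
  by rewrite -/c; ring.
rewrite -(Ex_refl (mid s p) i v mg) -(addr_restr_cons (base s) (fun=> v) ip).
rewrite (Ex_shift _ _ mg).
set La := glratio (base s) (restr (i :: p) (fun=> v)).
set Lb := glratio (base s) (restr p (fun=> v)).
have sLa : sqint (gauss (base s)) La by exact: sqint_glratio.
have sLb : sqint (gauss (base s)) Lb by exact: sqint_glratio.
have sLd := sqintB sLa sLb.
have uip : uniq (i :: p) by rewrite /= ip.
have dist : E (base s) (fun x => (La x - Lb x) ^+ 2) =
    expR ((size p).+1%:R * v ^+ 2) - expR ((size p)%:R * v ^+ 2).
  rewrite Ex_glratio_dist ?sum_restr_sq// => j.
  by rewrite /restr inE; case: ifP => jp; rewrite ?mul0r// orbT.
(* [La] is [Lb] times one ratio, so [refl_prob_mirror_le] bounds the arriving jump mass by |La -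
   Lb|. *)
have bound x : `|g x * La x| <= L / 2 * h x ^+ 2 + (2 * L)^-1 * (La x - Lb x) ^+ 2.
  apply: le_trans (mul_le_sq (h x) (La x - Lb x) L0).
  have -> : La x = Lb x * lratio v c (x i) by exact: glratio_cons.
  have -> : g x * (Lb x * lratio v c (x i)) =
    h x * (Lb x * (refl_prob v c (c + c + v - x i) * lratio v c (x i))) by rewrite /g; ring.
  have -> : Lb x * lratio v c (x i) - Lb x = Lb x * (lratio v c (x i) - 1) by ring.
  rewrite !normrM ler_wpM2l// ler_wpM2l//.
  have /andP[h1 h2] := refl_prob_mirror_le v c (x i).
  by rewrite -normrM ger0_norm.
have ibound : int1 (gauss (base s))
    (fun x => L / 2 * h x ^+ 2 + (2 * L)^-1 * (La x - Lb x) ^+ 2).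
  by apply: int1D; apply: int1Z; [exact: sh.2|exact: sLd.2].
apply: (@le_trans _ _ (E (base s)
    (fun x => L / 2 * h x ^+ 2 + (2 * L)^-1 * (La x - Lb x) ^+ 2))).
  apply: (Ex_le _ ibound).
    by apply: (int1_le _ ibound bound); exact: (measurable_funM mg sLa.1).
  by move=> x; apply: le_trans (bound x); rewrite ler_norm.
rewrite (ExD (int1Z _ sh.2) (int1Z _ sLd.2)) (ExZ _ sh.2) (ExZ _ sLd.2) dist.
by rewrite lerD2r ler_wpM2l// divr_ge0// ltW.
Qed.

(** [p] holds the coordinates already raised and [u] those still to come, which pile up on [p] in
    reverse order. The exponentials of [step_bound] telescope. *)
Lemma sweep_part s (L : R) u p l : 0 < L -> uniq (u ++ p) ->
  potential l (mid s (catrev u p)) <= potential (u ++ l) (mid s p) +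
   (size u)%:R * (L / 2 * M ^+ 2) + (2 * L)^-1 *
    (expR ((size u + size p)%:R * v ^+ 2) - expR ((size p)%:R * v ^+ 2)).
Proof.
move=> L0; elim: u p => [|i u IH] p.
  by move=> _; rewrite /= add0n subrr mulr0 mul0r !addr0.
move=> uiup.
have uuip : uniq (u ++ i :: p) by rewrite -cat1s uniq_catCA.
have /andP[ip up] : uniq (i :: p).
  by move: uuip; rewrite cat_uniq => /and3P[].
have mE : mid s (i :: p) = upd (mid s p) i (mid s p i + v).
  exact: (addr_restr_cons (base s) (fun=> v) ip).
have iW j : (j <= k)%N -> int1 (gauss (upd (mid s p) i (mid s p i + v)))
    (walk (u ++ l) (upd (mid s p) i (mid s p i + v)) j).
  move=> jk; rewrite -mE; apply: sqint_int1_shift.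
  by have [] := walk_sqint s (u ++ l) (mid s (i :: p)) jk.
have st := potential_step iW.
apply: le_trans (IH _ uuip) _.
rewrite [in leLHS]mE st.
have [_ sh hM] := walk_sqint s (u ++ l) (upd (mid s p) i (mid s p i + v)) (leqnn k).
have := step_bound L0 ip up sh hM.
rewrite /= addnS addSn -[(size u).+1]addn1 natrD.
set e1 := expR _; set e2 := expR _; set e3 := expR _.
move=> sb; lra.
Qed.

Local Notation e := (enum P).

Lemma sweep s (L : R) l : 0 < L ->
  potential l (base s.+1) <= potential (e ++ l) (base s) +
   ((size e)%:R * (L / 2 * M ^+ 2) + (2 * L)^-1 * (expR ((size e)%:R * v ^+ 2) - 1)).
Proof.
move=> L0; have := @sweep_part s L e [::] l L0.
rewrite cats0 enum_uniq => /(_ isT).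
have -> : mid s (catrev e [::]) = base s.+1.
  apply/funext => i; rewrite /restr /base catrevE cats0 mem_rev mem_enum unfold_in.
  by case: ifP => _; rewrite ?addr0// -(natr1 s) mulrDl mul1r.
by rewrite restr_nil addn0 mul0r expR0 addrA.
Qed.

(** When no coordinates remain, each of the [k] walks is [f] itself, so the final potential is [k]
    times the mean of [f]. *)
Lemma sweeps q s (L : R) : 0 < L ->
  k%:R * E (base (s + q)) f <= potential (flatten (nseq q e)) (base s) +
   q%:R * ((size e)%:R * (L / 2 * M ^+ 2) + (2 * L)^-1 * (expR ((size e)%:R * v ^+ 2) - 1)).
Proof.
move=> L0; elim: q s => [|q IH] s.
  by rewrite addn0 mul0r addr0 /potential /= sumr_const card_ord mulr_natl.
rewrite addnS -addSn; apply: le_trans (IH _) _.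
have := sweep s (flatten (nseq q e)) L0; rewrite -(natr1 q).
set B := _ + (2 * L)^-1 * _; rewrite [nseq _ _]/= [flatten _]/=.
by move=> h; rewrite mulrDl mul1r; lra.
Qed.

Lemma potential_le l :
  potential l (base 0) <= k%:R * E (base 0) f + k%:R * M.
Proof.
rewrite -mulrDr /potential.
have -> : k%:R * (E (base 0) f + M) = \sum_(j < k) (E (base 0) f + M).
  by rewrite sumr_const card_ord mulr_natl.
apply: ler_sum => j _.
have [sw sd dM] := walk_sqint 0 l (base 0) (ltn_ord j).
(* The weight 1/M splits the bound into two halves M/2. *)
have iM : 0 < M^-1 by rewrite invr_gt0.
have := Ex_mul_le iM sd (sqint_cst _ 1).
have -> : (fun x => (walk l (base 0) j.+1 x - f x) * 1) =
  (fun x => walk l (base 0) j.+1 x - f x) by apply/funext => x; rewrite mulr1.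
rewrite (ExB (sqint_int1 sw) (sqint_int1 (f_sqint 0))).
rewrite Ex_cst expr1n mulr1 invfM invrK.
have : M^-1 / 2 * E (base 0) (fun x => (walk l (base 0) j.+1 x - f x) ^+ 2) <= M / 2.
  apply: le_trans (ler_wpM2l _ dM) _; first by rewrite divr_ge0// ltW.
  by rewrite le_eqVlt; apply/orP; left; apply/eqP; field; rewrite gt_eqF.
by move: (E _ _) (E _ _) (E _ _) => *; lra.
Qed.

Variable beta : R.
Hypothesis f_bias : forall s, `|E (base s) f - s%:R * v| <= beta.

(** After [q] sweeps the mean of [f] has grown by q v up to the bias, so k q v is at most a constant
    plus [q] times the cost [B] of one sweep. Since [q] is arbitrary, k v <= [B]; the bound [beta]
    only enters the constant. *)
Theorem walk_sensitivity (L : R) : 0 < L ->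
  k%:R * v <= (size e)%:R * (L / 2 * M ^+ 2) +
    (2 * L)^-1 * (expR ((size e)%:R * v ^+ 2) - 1).
Proof.
move=> L0; set B := _ + _.
rewrite leNgt; apply/negP => Blt.
pose D := k%:R * (2 * beta + M).
have bnd (q : nat) : q%:R * (k%:R * v - B) <= D.
  have h1 := sweeps q 0 L0; rewrite add0n -/B in h1.
  have h2 := potential_le (flatten (nseq q e)).
  have b1 := f_bias q; have b2 := f_bias 0.
  have k0 : 0 <= k%:R :> R by [].
  have h3 : k%:R * (q%:R * v - beta) <= k%:R * E (base q) f.
    by apply: ler_wpM2l => //; move: b1; rewrite ler_norml => /andP[? ?]; lra.
  have h4 : k%:R * E (base 0) f <= k%:R * beta.
    by apply: ler_wpM2l => //; move: b2; rewrite mul0r subr0 ler_norml => /andP[? ?]; lra.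
  by rewrite /D; lra.
have dpos : 0 < k%:R * v - B by rewrite subr_gt0.
have := bnd (Num.bound (D / (k%:R * v - B))).
apply/negP; rewrite -ltNge -ltr_pdivrMr//.
have D0 : 0 <= D by have := bnd 0%N; rewrite mul0r.
by apply: archi_boundP; rewrite divr_ge0// ltW.
Qed.

End Walk.

(** * Clearing blocks of rows *)

Section Blocks.
Variables (R : realType) (n d k : nat).
Local Notation I := ('I_n * 'I_d)%type.
Local Notation prodT := (fspace R I).
Local Notation E m := (Ex (gauss m)).
Variables (F : 'I_d -> prodT -> R) (m : I -> R) (w : 'I_d -> R) (M : R).

(** Composing with it makes a function blind to one block, at the price of changing at most [k]
    rows. *)
Definition clear_block (b : nat) (x : prodT) : prodT :=
  fun ij => if (b * k <= ij.1 < b.+1 * k)%N then 0 else x ij.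

Lemma measurable_clear_block b : measurable_fun [set: prodT] (clear_block b).
Proof.
apply: measurable_to_prodT => i; rewrite /clear_block.
by case: (b * k <= i.1 < b.+1 * k)%N; [exact: measurable_cst|exact: measurable_coord].
Qed.

Lemma clear_block_upd b (x : prodT) (i : I) t : (b * k <= i.1 < b.+1 * k)%N ->
  clear_block b (upd x i t) = clear_block b x.
Proof.
move=> ib; apply/funext => j; rewrite /clear_block /upd.
by case: ifP => // jb; case: eqP => // ji; rewrite ji ib in jb.
Qed.

Hypothesis F_sqint : forall j, sqint (gauss m) (F j).
Hypothesis F_sens : forall b,
  (forall j, int1 (gauss m) (fun x => (F j x - F j (clear_block b x)) ^+ 2)) /\
  \sum_j E m (fun x => (F j x - F j (clear_block b x)) ^+ 2) <= M ^+ 2.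

Definition shift_upto (b : nat) (j : 'I_d) : I -> R :=
  fun ij => if (ij.2 == j) && (ij.1 < b * k)%N then w j else 0.

Local Notation sq a := (\sum_ij a ij * a ij).

(** [F0] ignores block [b], the only place where the two shifts differ, so its mean cancels. What
    remains is [D] paired with the difference of the densities. The sign [s] allows for increments
    in either direction. *)
Lemma block_step b j (s L : R) : s ^+ 2 = 1 -> 0 < L ->
  s * (E (fun i => m i + shift_upto b.+1 j i) (F j) -
       E (fun i => m i + shift_upto b j i) (F j)) <=
  L / 2 * E m (fun x => (F j x - F j (clear_block b x)) ^+ 2) +
  (2 * L)^-1 * (expR (sq (shift_upto b.+1 j)) - expR (sq (shift_upto b j))).
Proof.
move=> s1 L0.
pose F0 x := F j (clear_block b x); pose D x := F j x - F0 x.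
have mF := (F_sqint j).1.
have mF0 : measurable_fun [set: prodT] F0.
  exact: (measurableT_comp mF (measurable_clear_block b)).
have mD : measurable_fun [set: prodT] D by exact: measurable_funB.
have sD : sqint (gauss m) D by split; [|exact: (F_sens b).1].
have sF0 : sqint (gauss m) F0.
  have := sqintB (F_sqint j) sD.
  by congr sqint; apply/funext => x; rewrite /D subKr.
set a := shift_upto b j; set a' := shift_upto b.+1 j.
have indep : E (fun i => m i + a' i) F0 = E (fun i => m i + a i) F0.
  have -> : (fun i => m i + a' i) = (fun i => (m i + a i) + (a' i - a i)).
    by apply/funext => i; ring.
  apply: Ex_indep_shift => // i y t ai; rewrite /F0 clear_block_upd//.
  move: ai; rewrite /a /a' /shift_upto.
  case: (i.2 == j) => /=; last by rewrite subrr eqxx.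
  case: ltnP => h1; case: ltnP => h2; rewrite ?subrr ?subr0 ?eqxx// => _.
  (* No row lies among the first b blocks but outside the first b + 1. *)
  by have := leq_trans h2 (leq_trans (leq_mul (leqnSn b) (leqnn k)) h1); rewrite ltnn.
have split_ c : E (fun i => m i + c i) (F j) =
    E m (fun x => D x * glratio m c x) + E (fun i => m i + c i) F0.
  rewrite -(Ex_shift _ _ mD) -ExD.
  - by congr Ex; apply/funext => x; rewrite /D subrK.
  - exact: sqint_int1_shift.
  - exact: sqint_int1_shift.
have sLa : sqint (gauss m) (glratio m a) by exact: sqint_glratio.
have sLa' : sqint (gauss m) (glratio m a') by exact: sqint_glratio.
have sd := sqintB sLa' sLa.
rewrite !split_ indep.
have -> : s * (E m (fun x => D x * glratio m a' x) + E (fun i => m i + a i) F0 -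
    (E m (fun x => D x * glratio m a x) + E (fun i => m i + a i) F0)) =
  E m (fun x => D x * (s * (glratio m a' x - glratio m a x))).
  rewrite opprD addrACA subrr addr0.
  rewrite -(ExB (sqint_mul sD sLa') (sqint_mul sD sLa)).
  rewrite -(ExZ _ (int1B (sqint_mul sD sLa') (sqint_mul sD sLa))).
  by congr Ex; apply/funext => x; ring.
apply: le_trans (Ex_mul_le L0 sD (sqintZ s sd)) _.
have -> : (fun x => (s * (glratio m a' x - glratio m a x)) ^+ 2) =
    (fun x => (glratio m a' x - glratio m a x) ^+ 2).
  by apply/funext => x; rewrite exprMn s1 mul1r.
rewrite Ex_glratio_dist// => i.
rewrite /a /a' /shift_upto; case: (i.2 == j) => /=; last by rewrite mul0r.
case: ifP => h1; last by rewrite !mul0r.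
by rewrite (leq_trans h1)// leq_mul2r leqnSn orbT.
Qed.

(** Summing over the columns within each block spends the bound on the whole vector once, so the
    cost L/2 M^2 is paid per block and not per column. *)
Lemma blocks (s : 'I_d -> R) (L : R) b : (forall j, s j ^+ 2 = 1) -> 0 < L ->
  \sum_j s j * (E (fun i => m i + shift_upto b j i) (F j) - E m (F j)) <=
  b%:R * (L / 2 * M ^+ 2) + (2 * L)^-1 * \sum_j (expR (sq (shift_upto b j)) - 1).
Proof.
move=> s1 L0; elim: b => [|b IH].
  have z j : shift_upto 0 j = fun=> 0.
    by apply/funext => i; rewrite /shift_upto mul0n ltn0 andbF.
  rewrite big1 => [|j _]; last first.
    have -> : (fun i => m i + shift_upto 0 j i) = m.
      by apply/funext => i; rewrite z addr0.
    by rewrite subrr mulr0.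
  rewrite big1 => [|j _]; first by rewrite mul0r mulr0 addr0.
  by rewrite big1 ?expR0 ?subrr// => i _; rewrite z mulr0.
have st j := block_step b j (s1 j) L0.
have := ler_sum (index_enum _) (fun j (_ : true) => st j).
rewrite big_split /= -!mulr_sumr => h.
have hM : L / 2 * \sum_j E m (fun x => (F j x - F j (clear_block b x)) ^+ 2) <=
    L / 2 * M ^+ 2.
  by apply: ler_wpM2l (F_sens b).2; rewrite divr_ge0// ltW.
rewrite (eq_bigr (fun j => s j * (E (fun i => m i + shift_upto b j i) (F j) - E m (F j)) +
   s j * (E (fun i => m i + shift_upto b.+1 j i) (F j) -
       E (fun i => m i + shift_upto b j i) (F j)))); last by move=> j _; ring.
rewrite big_split /=.
rewrite [X in _ <= _ + _ * X](eq_bigr (fun j => (expR (sq (shift_upto b j)) - 1) +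
   (expR (sq (shift_upto b.+1 j)) - expR (sq (shift_upto b j))))); last by move=> j _; ring.
rewrite big_split /= -(natr1 b) mulrDr mulrDl mul1r.
by lra.
Qed.

Definition shift_col (j : 'I_d) : I -> R := fun ij => if ij.2 == j then w j else 0.

Theorem blocks_sensitivity (s : 'I_d -> R) (L : R) q :
  (forall j, s j ^+ 2 = 1) -> 0 < L -> (n <= q * k)%N ->
  \sum_j s j * (E (fun i => m i + shift_col j i) (F j) - E m (F j)) <=
  q%:R * (L / 2 * M ^+ 2) + (2 * L)^-1 * \sum_j (expR (n%:R * w j ^+ 2) - 1).
Proof.
move=> s1 L0 nq.
have e j : shift_upto q j = shift_col j.
  apply/funext => -[i j']; rewrite /shift_upto /shift_col /=.
  by rewrite (leq_trans (ltn_ord i) nq) andbT.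
have := blocks q s1 L0.
under eq_bigr do rewrite e.
under [X in _ <= _ + _ * X -> _]eq_bigr => j _.
  rewrite e /shift_col.
  rewrite -(pair_bigA _ (fun (i : 'I_n) (j' : 'I_d) =>
     (if j' == j then w j else 0) * (if j' == j then w j else 0)))/=.
  rewrite (eq_bigr (fun=> w j ^+ 2)); last first.
    move=> i _; rewrite (bigD1 j)//= eqxx big1 ?addr0 ?expr2// => j' /negbTE ->.
    by rewrite mul0r.
  rewrite sumr_const card_ord -mulr_natl.
over.
by [].
Qed.

End Blocks.

(** * Estimators and their sensitivity *)

Section Datasets.
Variables (R : realType) (n d : nat) (f : 'M[R]_(n, d) -> 'rV[R]_d).
Local Notation I := ('I_n * 'I_d)%type.
Local Notation prodT := (fspace R I).
Local Notation E m := (Ex (gauss m)).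

Definition dataset (x : prodT) : 'M[R]_(n, d) := \matrix_(i, j) x (i, j).
Definition coord_est (j : 'I_d) (x : prodT) : R := f (dataset x) 0 j.
Definition iid_mean (mu : 'I_d -> R) : I -> R := fun ij => mu ij.2.

(** The sets with measurable preimage form a sigma-algebra that contains the generators. *)
Lemma measurable_dataset (A : set 'M[R]_(n, d)) : mx_measurable A ->
  measurable (dataset @^-1` A).
Proof.
pose H := image_set_system [set: prodT] dataset measurable.
move=> mA; suff : H A by rewrite /H /image_set_system /= setTI.
apply: (smallest_sub _ _ mA).
  exact/sigma_algebra_image/sigma_algebra_measurable.
move=> _ [[i j] _ [B mB <-]] /=; rewrite /H /image_set_system /= setTI.
have -> : dataset @^-1` ((fun X : 'M[R]_(n, d) => X i j) @^-1` B) =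
    (fun x : prodT => x (i, j)) @^-1` B.
  by apply/funext => x; rewrite /preimage /= mxE.
by rewrite -[X in measurable X]setTI; exact: measurable_coord.
Qed.

Lemma measurable_coord_est j : mx_measurable_fun f ->
  measurable_fun [set: prodT] (coord_est j).
Proof.
move=> mf _ B mB; rewrite setTI.
exact: (measurable_dataset (mf j B mB)).
Qed.

Lemma l2norm_sq (v : 'rV[R]_d) : l2norm v ^+ 2 = \sum_j v 0 j ^+ 2.
Proof. by rewrite sqr_sqrtr// sumr_ge0// => j _; exact: sqr_ge0. Qed.

Lemma l2norm_ge_coord (v : 'rV[R]_d) j : `|v 0 j| <= l2norm v.
Proof.
rewrite -(@ler_pXn2r _ 2) ?nnegrE ?sqrtr_ge0// l2norm_sq real_normK ?num_real//.
by rewrite (bigD1 j)//= lerDl sumr_ge0// => i _; exact: sqr_ge0.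
Qed.

Lemma gauss_expectE (mu : 'rV[R]_d) (g : 'M[R]_(n, d) -> \bar R) :
  measurable_fun [set: prodT] (g \o dataset) -> (forall X, 0 <= g X)%E ->
  gauss_expect mu g = (\int[gauss (iid_mean (mu ord0))]_x g (dataset x))%E.
Proof.
move=> mg g0; exact: (gauss_iterE _ (index_enum_uniq _) mg (fun=> g0 _)).
Qed.

Lemma Ex_sum m (g : 'I_d -> prodT -> R) : (forall j, int1 (gauss m) (g j)) ->
  E m (fun x => \sum_j g j x) = \sum_j E m (g j).
Proof.
move=> ig; rewrite -[LHS]/(E m (fun x => \sum_(j <- index_enum 'I_d) g j x)).
have : int1 (gauss m) (fun x => \sum_(j <- index_enum 'I_d) g j x) /\
   E m (fun x => \sum_(j <- index_enum 'I_d) g j x) =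
   \sum_(j <- index_enum 'I_d) E m (g j).
  elim: (index_enum 'I_d) => [|j s [IH1 IH2]].
    have -> : (fun x : prodT => \sum_(j <- [::]) g j x) = (fun=> 0).
      by apply/funext => x; rewrite big_nil.
    by rewrite Ex_cst big_nil; split => //; exact: int1_cst.
  have -> : (fun x : prodT => \sum_(j <- j :: s) g j x) =
     (fun x => g j x + \sum_(j <- s) g j x).
    by apply/funext => x; rewrite big_cons.
  by rewrite ExD// big_cons IH2; split => //; exact: int1D.
by case.
Qed.

Lemma measurable_sum_sq (g : 'I_d -> prodT -> R) :
  (forall j, measurable_fun [set: prodT] (g j)) ->
  measurable_fun [set: prodT] (fun x => \sum_j g j x ^+ 2).
Proof.
move=> mg; apply: measurable_sum => j.
exact: measurable_funX.
Qed.

Lemma sum_sq_split m (g : 'I_d -> prodT -> R) :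
  (forall j, measurable_fun [set: prodT] (g j)) ->
  int1 (gauss m) (fun x => \sum_j g j x ^+ 2) ->
  (forall j, int1 (gauss m) (fun x => g j x ^+ 2)) /\
  \sum_j E m (fun x => g j x ^+ 2) = E m (fun x => \sum_j g j x ^+ 2).
Proof.
move=> mg ig.
have igj j : int1 (gauss m) (fun x => g j x ^+ 2).
  apply: (int1_le _ ig) => [|x]; first exact: measurable_funX.
  rewrite ger0_norm ?sqr_ge0// (bigD1 j)//= lerDl sumr_ge0// => i _.
  exact: sqr_ge0.
by split => //; rewrite Ex_sum.
Qed.

Lemma mse_coord C (mu : 'I_d -> R) : 0 <= C -> mx_measurable_fun f ->
  unif_MSE_accurate f C ->
  (forall j, sqint (gauss (iid_mean mu)) (fun x => coord_est j x - mu j)) /\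
  \sum_j E (iid_mean mu) (fun x => (coord_est j x - mu j) ^+ 2) <= C * (d%:R / n%:R).
Proof.
move=> C0 mf /(_ (\row_j mu j)).
have mD j : measurable_fun [set: prodT] (fun x => coord_est j x - mu j).
  by apply: measurable_funB; [exact: measurable_coord_est|exact: measurable_cst].
pose q (x : prodT) := \sum_j (coord_est j x - mu j) ^+ 2.
have mq : measurable_fun [set: prodT] q by exact: measurable_sum_sq.
have q0 x : 0 <= q x by apply: sumr_ge0 => j _; exact: sqr_ge0.
have qE x : l2norm (f (dataset x) - \row_j mu j) ^+ 2 = q x.
  by rewrite l2norm_sq; apply: eq_bigr => j _; rewrite !mxE.
rewrite gauss_expectE; last 2 first.
- have -> : (fun X => (l2norm (f X - \row_j mu j) ^+ 2)%:E) \o dataset =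
      (fun x => (q x)%:E) by apply/funext => x; rewrite /= qE.
  exact/measurable_EFinP.
- by move=> X; rewrite lee_fin sqr_ge0.
have -> : iid_mean ((\row_j mu j) ord0) = iid_mean mu.
  by apply/funext => ij; rewrite /iid_mean mxE.
under eq_integral do rewrite qE.
move=> qC; have [iq Eq] := Ex_ge0_le (mulr_ge0 C0 (divr_ge0 (ler0n _ d) (ler0n _ n))) mq q0 qC.
have [iD ED] := sum_sq_split mD iq.
split; last by rewrite ED.
by move=> j; split.
Qed.

Variables (eta : R) (k : nat).
Hypothesis eta_k : floor_eta_n n eta = k%:Z.

Lemma sens_ge (X X' : 'M[R]_(n, d)) : (hamming X X' <= k)%N ->
  ((l2norm (f X - f X'))%:E <= pointwise_sens f eta X)%E.
Proof.
move=> XX'; apply: ereal_sup_ubound; exists X' => //=.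
by rewrite eta_k lez_nat.
Qed.

Lemma hammingE (X X' : 'M[R]_(n, d)) :
  hamming X X' = #|[pred i : 'I_n | row i X != row i X']|.
Proof.
by apply: eq_card => i; rewrite [RHS]inE; apply/idP/idP; rewrite inE.
Qed.

Lemma hamming_refl (X : 'M[R]_(n, d)) : hamming X X = 0%N.
Proof. by rewrite hammingE; apply: eq_card0 => i; rewrite inE eqxx. Qed.

Lemma sens_ge0 X : (0 <= pointwise_sens f eta X)%E.
Proof.
apply: le_trans (@sens_ge X X _); last by rewrite hamming_refl.
by rewrite lee_fin sqrtr_ge0.
Qed.

(** An update changes one entry, hence at most one row. *)
Lemma reach_hamming j (x y : prodT) : reach j x y ->
  (hamming (dataset x) (dataset y) <= j)%N.
Proof.
elim => [j' x'|j' x' [i c] t y' _ IH]; first by rewrite hamming_refl.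
rewrite -add1n; apply: leq_trans (leq_add (leqnn 1) IH).
rewrite !hammingE.
set B := [pred r | row r (dataset (upd x' (i, c) t)) != row r (dataset y')].
apply: (@leq_trans #|[predU1 i & B]|); last by rewrite cardU1 leq_add2r leq_b1.
apply/subset_leq_card/fintype.subsetP => r; rewrite !inE.
have [//|ri /=] := eqVneq r i.
have -> // : row r (dataset (upd x' (i, c) t)) = row r (dataset x').
apply/rowP => l; rewrite !mxE upd_neq//.
by apply/eqP => -[/eqP]; rewrite (negbTE ri).
Qed.

Lemma clear_block_hamming b (x : prodT) :
  (hamming (dataset x) (dataset (clear_block k b x)) <= k)%N.
Proof.
rewrite hammingE.
apply: (@leq_trans #|[pred i : 'I_n | (b * k <= i < b.+1 * k)%N]|).
  apply/subset_leq_card/fintype.subsetP => r; rewrite !inE.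
  apply: contraNT => rb; apply/eqP/rowP => l; rewrite !mxE /clear_block /=.
  by rewrite (negbTE rb).
set B := [pred i | _].
have u : uniq (map val (enum B)) by rewrite map_inj_uniq ?enum_uniq//; exact: val_inj.
have s : {subset map val (enum B) <= iota (b * k) k}.
  move=> r /mapP[i]; rewrite mem_enum inE => ib ->.
  by rewrite mem_iota; move: ib; rewrite mulSn addnC.
by have := uniq_leq_size u s; rewrite size_map size_iota cardE.
Qed.

Variable M : R.
Hypothesis M0 : 0 < M.
Hypothesis ES_M : forall mu, (ES2 f eta mu < M%:E)%E.

(** For measurable [q] the integral is an iterated integral, and this one is monotone even against
    the squared sensitivity. [ES_M] bounds the latter and rules out the value +oo. *)
Lemma sens_domination (mu : 'I_d -> R) (q : prodT -> R) :
  measurable_fun [set: prodT] q -> (forall x, 0 <= q x) ->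
  (forall x, (q x)%:E <= pointwise_sens f eta (dataset x) *
                         pointwise_sens f eta (dataset x))%E ->
  int1 (gauss (iid_mean mu)) q /\ E (iid_mean mu) q <= M ^+ 2.
Proof.
move=> mq q0 qS; apply: (Ex_ge0_le (sqr_ge0 M) mq q0).
have := ES_M (\row_j mu j); rewrite /ES2.
set A := gauss_expect _ _.
have qA : (\int[gauss (iid_mean mu)]_x (q x)%:E <= A)%E.
  have mqE : measurable_fun [set: prodT] (fun x => (q x)%:E) by exact/measurable_EFinP.
  have q0E x : (0 <= (q x)%:E)%E by rewrite lee_fin.
  rewrite /gauss -(gauss_iterE _ (index_enum_uniq _) mqE q0E).
  have -> : A = gauss_iter (index_enum I) (iid_mean mu)
     (fun x : prodT => (pointwise_sens f eta (dataset x) *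
                        pointwise_sens f eta (dataset x))%E) (fun=> 0).
    rewrite /A /gauss_expect; congr gauss_iter.
    by apply/funext => ij; rewrite /iid_mean mxE.
  by case/andP: (le_gauss_iter (index_enum I) (iid_mean mu) (fun=> 0) q0E qS).
have A0 : (0 <= A)%E.
  by apply: le_trans qA; apply: integral_ge0 => x _; rewrite lee_fin.
move=> AM; apply: le_trans qA _; move: A A0 AM => [a||]//=.
rewrite !lee_fin lte_fin => a0 aM.
by rewrite -(sqr_sqrtr a0) lerXn2r// ?nnegrE ?sqrtr_ge0// ltW.
Qed.

End Datasets.

(** * The two lower bounds on the sensitivity *)

Section LowerBounds.
Variables (R : realType) (n d : nat) (f : 'M[R]_(n, d) -> 'rV[R]_d).
Local Notation I := ('I_n * 'I_d)%type.
Local Notation prodT := (fspace R I).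
Local Notation E m := (Ex (gauss m)).
Variables (eta : R) (k : nat) (M C : R).
Hypothesis mf : mx_measurable_fun f.
Hypothesis C0 : 0 < C.
Hypothesis fC : unif_MSE_accurate f C.
Hypothesis eta_k : floor_eta_n n eta = k%:Z.
Hypothesis M0 : 0 < M.
Hypothesis ES_M : forall mu, (ES2 f eta mu < M%:E)%E.
Hypothesis n0 : (0 < n)%N.

Local Notation F := (coord_est f).

Lemma coord_est_sqint (mu : 'I_d -> R) j : sqint (gauss (iid_mean mu)) (F j).
Proof.
have [sD _] := mse_coord mu (ltW C0) mf fC.
have := sqintD (sD j) (sqint_cst _ (mu j)).
by congr sqint; apply/funext => x; rewrite subrK.
Qed.

(** The weighted product bound is applied to the error and a constant sign; the two signs give the
    absolute value. *)
Lemma bias_le (mu : 'I_d -> R) j (l : R) : 0 < l ->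
  `|E (iid_mean mu) (F j) - mu j| <=
   l / 2 + (2 * l)^-1 * E (iid_mean mu) (fun x => (F j x - mu j) ^+ 2).
Proof.
move=> l0; have [sD _] := mse_coord mu (ltW C0) mf fC.
have h s : s ^+ 2 = 1 -> s * (E (iid_mean mu) (F j) - mu j) <=
   l / 2 + (2 * l)^-1 * E (iid_mean mu) (fun x => (F j x - mu j) ^+ 2).
  move=> s1; have := Ex_mul_le l0 (sqint_cst (gauss (iid_mean mu)) s) (sD j).
  rewrite Ex_cst s1 mulr1; apply: le_trans.
  rewrite (ExZ _ (sqint_int1 (sD j))).
  by rewrite (ExB (sqint_int1 (coord_est_sqint mu j)) (int1_cst _ _)) Ex_cst.
have e : (-1) ^+ 2 = 1 :> R by rewrite sqrrN expr1n.
rewrite ler_norml; have := h 1 (expr1n _ _); have := h (-1) e.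
by move: (E _ _) (E _ _) => *; apply/andP; split; lra.
Qed.

Lemma sens_diff_sq_le x x' : (hamming (dataset x) (dataset x') <= k)%N ->
  ((\sum_j (F j x - F j x') ^+ 2)%:E <=
    pointwise_sens f eta (dataset x) * pointwise_sens f eta (dataset x))%E.
Proof.
move=> /(sens_ge f eta_k) h.
have -> : \sum_j (F j x - F j x') ^+ 2 =
    l2norm (f (dataset x) - f (dataset x')) * l2norm (f (dataset x) - f (dataset x')).
  by rewrite -expr2 l2norm_sq; apply: eq_bigr => j _; rewrite !mxE.
by rewrite EFinM lee_pmul// lee_fin sqrtr_ge0.
Qed.

Lemma eta_bound : (0 < d)%N -> k%:R / n%:R <= M * expR 1 / 2.
Proof.
move=> d0; pose j0 : 'I_d := Ordinal d0.
have nR : 0 < n%:R :> R by rewrite ltr0n.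
(* With this step size n v^2 = 1, so the exponential in the cost of a sweep is e. *)
pose v : R := Num.sqrt (n%:R^-1).
have v0 : 0 < v by rewrite sqrtr_gt0 invr_gt0.
have v2 : n%:R * v ^+ 2 = 1 by rewrite sqr_sqrtr ?invr_ge0 ?ltW// divff// gt_eqF.
pose P : pred I := fun ij => ij.2 == j0.
pose mu (s : nat) : 'I_d -> R := fun j => if j == j0 then s%:R * v else 0.
have baseE s : base v P s = iid_mean (mu s) by [].
have muj0 s : mu s j0 = s%:R * v by rewrite /mu eqxx.
have sizeP : size (enum P) = n.
  have inj : injective (fun i : 'I_n => (i, j0)) by move=> i i' [].
  rewrite -cardE -[RHS]card_ord -(fintype.card_image inj).
  apply: eq_card => -[i j]; rewrite unfold_in /P /=.
  by apply/eqP/fintype.imageP => [->|[i' _ [_ ->//]]]; exists i.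
have fs s : sqint (gauss (base v P s)) (F j0).
  by rewrite baseE; exact: coord_est_sqint.
have fsens s (h : prodT -> R) : measurable_fun [set: prodT] h ->
  (forall x (D : R), (forall y, reach k x y -> `|F j0 y - F j0 x| <= D) -> `|h x| <= D) ->
  int1 (gauss (base v P s)) (fun x => h x ^+ 2) /\
  E (base v P s) (fun x => h x ^+ 2) <= M ^+ 2.
  move=> mh hD; rewrite baseE.
  apply: (sens_domination M0 ES_M) => [||x].
  - exact: measurable_funX.
  - by move=> x; exact: sqr_ge0.
  have S0 := sens_ge0 f eta_k (dataset x).
  have hS : (`|h x|%:E <= pointwise_sens f eta (dataset x))%E.
    move: (@sens_ge _ _ _ f _ _ eta_k (dataset x)) S0.
    case: (pointwise_sens f eta (dataset x)) => [r hr _|_ _|_]; [|exact: leey|by []].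
    rewrite lee_fin; apply: hD => y /reach_hamming xy.
    have := hr _ xy; rewrite lee_fin; apply: le_trans.
    have := l2norm_ge_coord (f (dataset x) - f (dataset y)) j0.
    by rewrite !mxE distrC.
  by rewrite -(real_normK (num_real (h x))) expr2 EFinM lee_pmul// lee_fin.
(* The bias only has to be bounded uniformly in [s], since [beta] is absent from the conclusion of
   [walk_sensitivity]. *)
have fb s : `|E (base v P s) (F j0) - s%:R * v| <= 1 / 2 + (2 * 1)^-1 * (C * (d%:R / n%:R)).
  rewrite baseE -muj0; apply: le_trans (bias_le (mu s) j0 ltr01) _.
  rewrite lerD2l ler_wpM2l//.
  have [_ sm] := mse_coord (mu s) (ltW C0) mf fC.
  apply: le_trans sm; rewrite (bigD1 j0)//= lerDl sumr_ge0// => j _.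
  by apply: Rintegral_ge0 => x _; exact: sqr_ge0.
(* This weight makes the two terms M/(2v) and M(e - 1)/(2v), together M e/(2v). *)
have L0 : 0 < v / M by rewrite divr_gt0.
have := walk_sensitivity (measurable_coord_est j0 mf) M0 fs fsens fb L0.
rewrite sizeP v2 => h.
have e1 : n%:R = v ^- 2.
  by apply: (mulIf (x := v ^+ 2)); rewrite ?v2 ?mulVf// expf_neq0// gt_eqF.
have h2 := ler_wpM2r (ltW v0) h.
have -> : k%:R / n%:R = k%:R * v * v by rewrite e1 invrK expr2 mulrA.
apply: le_trans h2 _; rewrite e1 le_eqVlt; apply/orP; left; apply/eqP.
by field; rewrite !gt_eqF.
Qed.

Definition flip (j : 'I_d) (e : {ffun 'I_d -> bool}) : {ffun 'I_d -> bool} :=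
  [ffun i => if i == j then ~~ e i else e i].

Lemma flipK j : involutive (flip j).
Proof.
by move=> e; apply/ffunP => i; rewrite !ffunE; case: (i == j); rewrite ?negbK.
Qed.

Definition cube_mean (v : R) (e : {ffun 'I_d -> bool}) : 'I_d -> R :=
  fun j => if e j then v else 0.

Local Notation mse v e j :=
  (E (iid_mean (cube_mean v e)) (fun x => (F j x - cube_mean v e j) ^+ 2)).

(** Flipping coordinate j permutes the cube, so both sums have the same average over the vertices,
    at most C d/n, and some vertex is no worse than the average. *)
Lemma cube_vertex v : exists e : {ffun 'I_d -> bool},
  \sum_j (mse v e j + mse v (flip j e) j) <= 2 * (C * (d%:R / n%:R)).
Proof.
apply/not_existsP => all_gt.
have : \sum_(e : {ffun 'I_d -> bool}) \sum_j (mse v e j + mse v (flip j e) j) <=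
       \sum_(e : {ffun 'I_d -> bool}) 2 * (C * (d%:R / n%:R)).
  have mseC e : \sum_j mse v e j <= C * (d%:R / n%:R).
    by have [] := mse_coord (cube_mean v e) (ltW C0) mf fC.
  under eq_bigr do rewrite big_split.
  rewrite big_split /=.
  have -> : \sum_(e : {ffun 'I_d -> bool}) \sum_j mse v (flip j e) j =
            \sum_(e : {ffun 'I_d -> bool}) \sum_j mse v e j.
    rewrite exchange_big [RHS]exchange_big; apply: eq_bigr => j _ /=.
    rewrite [RHS](reindex_inj (inv_inj (flipK j))).
    by apply: eq_bigr => e _.
  rewrite -big_split; apply: ler_sum => e _ /=.
  by have := mseC e; lra.
apply/negP; rewrite -ltNge; apply: ltr_sum => [|e _].
  by apply/hasP; exists [ffun=> false]; rewrite ?mem_index_enum.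
by rewrite ltNge; apply/negP/all_gt.
Qed.

(** [y] and [x] are the means of one coordinate of [f] before and after a flip in direction [t]. The
    terms v/8 come from [bias_le] with weight v/4. *)
Lemma signed_gap (v c x y a b t : R) : `|x - (c + t * v)| <= v / 8 + a ->
  `|y - c| <= v / 8 + b -> t = 1 \/ t = -1 ->
  v - v / 4 - (b + a) <= t * (x - y).
Proof.
rewrite !ler_norml => /andP[x1 x2] /andP[y1 y2] [t1|t1]; rewrite t1 in x1 x2 *.
  lra.
lra.
Qed.

Hypothesis k0 : (0 < k)%N.
Hypothesis kn : (k <= n)%N.

Lemma sqrt_bound :
  2 * C * (d%:R * k%:R / n%:R ^+ 2) <= (expR (16 * C) - 1) * M ^+ 2.
Proof.
have nR : 0 < n%:R :> R by rewrite ltr0n.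
have kR : 0 < k%:R :> R by rewrite ltr0n.
(* The factor 4 gives v^2 = 16 C/n. Out of the total displacement d v, the terms v/8 then take d v/4
   and the mean squared errors another d v/4, which leaves d v/2. *)
pose v : R := 4 * Num.sqrt (C / n%:R).
have Cn : 0 < C / n%:R by rewrite divr_gt0.
have v0 : 0 < v by rewrite mulr_gt0// sqrtr_gt0.
have v2 : v ^+ 2 = 16 * (C / n%:R).
  by rewrite exprMn sqr_sqrtr ?ltW// -natrX.
have nv2 : n%:R * v ^+ 2 = 16 * C by rewrite v2; field; rewrite gt_eqF.
set B := expR (16 * C) - 1.
have B0 : 0 < B by rewrite subr_gt0 expR_gt1 mulr_gt0.
have [e he] := cube_vertex v.
pose m := iid_mean (n := n) (cube_mean v e).
pose w (j : 'I_d) : R := if e j then - v else v.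
pose s (j : 'I_d) : R := if e j then -1 else 1.
have s1 j : s j ^+ 2 = 1 by rewrite /s; case: (e j); rewrite ?sqrrN expr1n.
have mE j : (fun i => m i + shift_col w j i) = iid_mean (cube_mean v (flip j e)).
  apply/funext => i; rewrite /m /shift_col /iid_mean /cube_mean /w ffunE.
  case: eqP => [->|_]; last by rewrite addr0.
  by case: (e j) => /=; rewrite ?subrr ?add0r.
have Fs j : sqint (gauss m) (F j) by exact: coord_est_sqint.
have Fsens b :
  (forall j, int1 (gauss m) (fun x => (F j x - F j (clear_block k b x)) ^+ 2)) /\
  \sum_j E m (fun x => (F j x - F j (clear_block k b x)) ^+ 2) <= M ^+ 2.
  have mD j : measurable_fun [set: prodT] (fun x => F j x - F j (clear_block k b x)).
    have mFj := measurable_coord_est j mf.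
    apply: measurable_funB => //.
    exact: (measurableT_comp mFj (measurable_clear_block k b)).
  have [iq Eq] : int1 (gauss m) (fun x => \sum_j (F j x - F j (clear_block k b x)) ^+ 2) /\
     E m (fun x => \sum_j (F j x - F j (clear_block k b x)) ^+ 2) <= M ^+ 2.
    apply: (sens_domination M0 ES_M) => [||x].
    - exact: measurable_sum_sq.
    - by move=> x; apply: sumr_ge0 => j _; exact: sqr_ge0.
    - by apply: sens_diff_sq_le; exact: clear_block_hamming.
  have [iD ED] := sum_sq_split mD iq.
  by split => //; rewrite ED.
(* The extra block covers an incomplete remainder, and still q k <= n + k <= 2n. *)
pose q := (n %/ k).+1.
have nq : (n <= q * k)%N by rewrite ltnW// -ltn_divLR.
have qk : q%:R * k%:R <= 2 * n%:R :> R.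
  have : (q * k <= 2 * n)%N by rewrite /q mulSn mul2n -addnn leq_add// leq_divM.
  by rewrite -(ler_nat R) !natrM.
(* This weight makes the density term d v/4, half of the lower bound [low], so that it can be
   absorbed. *)
have L0 : 0 < 2 * B / v by rewrite divr_gt0// mulr_gt0.
have := blocks_sensitivity w Fs Fsens s1 L0 nq.
have -> : \sum_j (expR (n%:R * w j ^+ 2) - 1) = d%:R * B.
  rewrite (eq_bigr (fun=> B)) => [|j _]; last first.
    have -> : w j ^+ 2 = v ^+ 2 by rewrite /w; case: (e j); rewrite ?sqrrN.
    by rewrite nv2.
  by rewrite sumr_const card_ord mulr_natl.
have low : d%:R * v / 2 <=
    \sum_j s j * (E (fun i => m i + shift_col w j i) (F j) - E m (F j)).
  have l4 : 0 < v / 4 by rewrite divr_gt0.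
  have lowj j : v - v / 4 - 2 / v * (mse v e j + mse v (flip j e) j) <=
      s j * (E (fun i => m i + shift_col w j i) (F j) - E m (F j)).
    have h2v : (2 * (v / 4))^-1 = 2 / v by field; rewrite gt_eqF.
    have h8 : v / 4 / 2 = v / 8 by field.
    have flipE : cube_mean v (flip j e) j = cube_mean v e j + s j * v.
      by rewrite /cube_mean /s ffunE eqxx; case: (e j) => /=; ring.
    rewrite mE mulrDr; apply: (signed_gap (c := cube_mean v e j)).
    - by rewrite -flipE -h2v -h8; exact: bias_le.
    - by rewrite -h2v -h8; exact: bias_le.
    - by rewrite /s; case: (e j); [right|left].
  apply: le_trans (ler_sum _ (fun j _ => lowj j)).
  rewrite sumrB sumr_const card_ord -mulr_sumr -mulr_natl.
  have hv : 2 / v * \sum_j (mse v e j + mse v (flip j e) j) <= d%:R * v / 4.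
    apply: le_trans (ler_wpM2l _ he) _; first by rewrite divr_ge0// ltW.
    have -> : 2 / v * (2 * (C * (d%:R / n%:R))) = d%:R * (16 * (C / n%:R)) / v / 4.
      by field; rewrite !gt_eqF.
    rewrite -v2 le_eqVlt; apply/orP; left; apply/eqP; field.
    by rewrite gt_eqF.
  by move: hv; set S := \sum_j _ => hv; lra.
move=> up; have := le_trans low up.
have -> : (2 * (2 * B / v))^-1 * (d%:R * B) = d%:R * v / 4.
  by field; rewrite !gt_eqF.
have -> : q%:R * (2 * B / v / 2 * M ^+ 2) = q%:R * (B / v * M ^+ 2).
  by congr (_ * _); field; rewrite gt_eqF.
move=> h1.
have h2 : d%:R * v / 4 <= q%:R * (B / v * M ^+ 2) by lra.
have h3 : d%:R * v ^+ 2 / 4 <= q%:R * (B * M ^+ 2).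
  have := ler_wpM2r (ltW v0) h2.
  have -> : q%:R * (B / v * M ^+ 2) * v = q%:R * (B * M ^+ 2) by field; rewrite gt_eqF.
  by have -> : d%:R * v / 4 * v = d%:R * v ^+ 2 / 4 by ring.
have h4 : d%:R * v ^+ 2 / 4 * k%:R <= 2 * n%:R * (B * M ^+ 2).
  apply: le_trans (ler_wpM2r (ltW kR) h3) _.
  rewrite mulrAC ler_wpM2r// mulr_ge0 ?sqr_ge0// ltW//.
have nv : 0 <= (2 * n%:R)^-1 :> R by rewrite invr_ge0 mulr_ge0// ltW.
have := ler_wpM2l nv h4; rewrite v2.
have -> : (2 * n%:R)^-1 * (2 * n%:R * (B * M ^+ 2)) = B * M ^+ 2.
  by field; rewrite gt_eqF.
by apply: le_trans; rewrite le_eqVlt; apply/orP; left; apply/eqP; field; rewrite gt_eqF.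
Qed.

End LowerBounds.

(** * Combining the two bounds *)

Theorem theorem3p1 (R : realType) (C_MSE : R) (HC : 0 < C_MSE) :
  exists (c : R) (N0 : nat), 0 < c /\
    forall (d n : nat) (f : 'M[R]_(n, d) -> 'rV[R]_d) (eta : R),
      (1 <= d)%N -> (N0 <= n)%N ->
      mx_measurable_fun f ->
      unif_MSE_accurate f C_MSE ->
      0 < eta < 1 ->
      (1 <= floor_eta_n n eta) ->
      ((c * (eta + Num.sqrt (eta * d%:R / n%:R)))%:E
         <= ereal_sup [set ES2 f eta mu | mu in [set: 'rV[R]_d]])%E.
Proof.
pose B := expR (16 * C_MSE) - 1.
have B0 : 0 < B by rewrite subr_gt0 expR_gt1 mulr_gt0.
(* If every ES2 is below M, the two bounds give eta < e M and sqrt(eta d/n) <= sqrt(B/C) M. The sum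
   of these factors is [K], which contradicts M = tau/K. *)
pose K := expR 1 + Num.sqrt (B / C_MSE).
have K0 : 0 < K by rewrite ltr_pwDl ?expR_gt0 ?sqrtr_ge0.
exists K^-1, 1%N; split; first by rewrite invr_gt0.
move=> d n f eta d1 n1 mf fC /andP[eta0 eta1] k1.
rewrite leNgt; apply/negP => supM.
have nR : 0 < n%:R :> R by rewrite ltr0n.
set tau := eta + _ in supM; set M := K^-1 * tau in supM.
have tau0 : 0 < tau by rewrite ltr_pwDl ?sqrtr_ge0.
have M0 : 0 < M by rewrite mulr_gt0 ?invr_gt0.
have [k eta_k] : exists k, floor_eta_n n eta = k%:Z.
  by move: k1; case: (floor_eta_n n eta) => // k _; exists k.
have k0 : (0 < k)%N by move: k1; rewrite eta_k lez_nat.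
have kR : 1 <= k%:R :> R by rewrite ler1n.
have k_le : k%:R <= eta * n%:R.
  have := floor_le (eta * n%:R); rewrite -/(floor_eta_n n eta) eta_k.
  by [].
have k_gt : eta * n%:R < k%:R + 1.
  have := floorD1_gt (eta * n%:R); rewrite -/(floor_eta_n n eta) eta_k.
  by rewrite intrD.
have kn : (k <= n)%N.
  rewrite -(ler_nat R); apply: le_trans k_le _.
  by rewrite ler_piMl// ltW.
have ES_M mu : (ES2 f eta mu < M%:E)%E.
  by apply: le_lt_trans supM; apply: ereal_sup_ubound; exists mu.
have b1 := eta_bound mf HC fC eta_k M0 ES_M n1 d1.
have b2 := sqrt_bound mf HC fC eta_k M0 ES_M n1 k0 kn.
(* The floor loses at most a factor 2: eta n < k + 1 <= 2k because k >= 1. *)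
have eta_lt : eta < 2 * (k%:R / n%:R).
  rewrite mulrA ltr_pdivlMr//; lra.
have t1 : eta < expR 1 * M by lra.
have t2 : Num.sqrt (eta * d%:R / n%:R) <= Num.sqrt (B / C_MSE) * M.
  have -> : Num.sqrt (B / C_MSE) * M = Num.sqrt (B / C_MSE * M ^+ 2).
    by rewrite [in RHS]sqrtrM ?divr_ge0 ?ltW// sqrtr_sqr gtr0_norm.
  apply: ler_wsqrtr.
  apply: (@le_trans _ _ (2 * (d%:R * k%:R / n%:R ^+ 2))).
    have -> : 2 * (d%:R * k%:R / n%:R ^+ 2) = 2 * (k%:R / n%:R) * d%:R / n%:R :> R.
      by field; rewrite gt_eqF.
    apply: ler_wpM2r; first by rewrite invr_ge0 ltW.
    by apply: ler_wpM2r => //; exact: ltW.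
  rewrite [leRHS]mulrAC ler_pdivlMr//; apply: le_trans b2.
  by rewrite le_eqVlt; apply/orP; left; apply/eqP; ring.
have : tau < K * M by rewrite /tau /K mulrDl; exact: ltr_leD.
by rewrite /M mulrA divff ?gt_eqF// mul1r ltxx.
Qed.
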